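(* In the setting of the context, suppose that: (1) $f$, $g\circ T$ and $h$ belong to $\Gamma_0(\mathcal H_p)$; (2) the pair $(f,\mathcal C)$ is $(F,\zeta)$-smooth for some $F:\mathcal H_p\to\mathbb R\cup\{+\infty\}$ and $\zeta:]0,1]\to\mathbb R_+$; (3) $\mathcal C=\mathrm{dom}(h)$ is weakly compact; (4) $T\mathcal C\subset \mathrm{dom}(\partial g)$ and $\sup_{x\in\mathcal C}\|[\partial g(Tx)]^0\|<\infty$; (5) $h$ is Lipschitz continuous relative to $\mathcal C$ with constant $L_h\ge0$, i.e. $|h(x)-h(z)|\le L_h\|x-z\|$ for all $x,z\in\mathcal C$; (6) there exists a saddle point of $\mathcal L$ in $\mathcal H_p\times\mathcal H_d$; (7) $\mathrm{ran}(A)$ is closed; (8) either (a) $A^{-1}(b)\cap\mathrm{int}(\mathrm{dom}(g\circ T))\cap\mathrm{int}(\mathcal C)\ne\emptyset$, or (b) $\mathcal H_p$ and $\mathcal H_d$ are finite dimensional, $A^{-1}(b)\cap\mathrm{ri}(\mathrm{dom}(g\circ T))\cap\mathrm{ri}(\mathcal C)\ne\emptyset$ and $\mathrm{ran}(A^* )\cap\mathrm{LinHull}(\mathrm{dom}(g\circ T)\cap\mathcal C)^\perp=\{0\}$. Suppose the parameters satisfy: (9) $(\gamma_k)\subset\,]0,1]$ and the sequences $(\zeta(\gamma_k))_k$, $(\gamma_k^2/\beta_k)_k$, $(\gamma_k\beta_k)_k$ belong to $\ell^1_+$; (10) $(\gamma_k)_k\notin\ell^1$; (11) $(\beta_k)_k$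 is non-increasing and converges to $0$; (12) $(\rho_k)_k$ is non-decreasing with $0<\underline\rho=\inf_k\rho_k\le\sup_k\rho_k=\overline\rho<+\infty$; (13) for some constants $\underline M_\gamma\geq 1$ and $\overline M_\gamma>0$, $\underline M_\gamma\le\inf_k(\gamma_k/\gamma_{k+1})\le\sup_k(\gamma_k/\gamma_{k+1})\le\overline M_\gamma$; (14) $\theta_k=\gamma_k/c$ for all $k\in\mathbb N$, for some $c>0$ such that $\overline M_\gamma/c-\underline\rho/2<0$; (15) $\rho_{k+1}-\rho_k-\gamma_{k+1}\rho_{k+1}+\frac2c\gamma_k-\frac{\gamma_k^2}{c}\le\gamma_{k+1}$ for all $k\in\mathbb N$, with the same $c$. If the primal problem admits a unique solution $x^\star$, then the sequence of primal-dual pairs $(x_k,\mu_k)_k$ generated by the algorithm in the context converges weakly to a saddle point $(x^\star,\mu^\star)$ of $\mathcal L$.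
   Context: Setting. $\mathcal H_p,\mathcal H_d,\mathcal H_v$ are real Hilbert spaces, $A:\mathcal H_p\to\mathcal H_d$ and $T:\mathcal H_p\to\mathcal H_v$ are bounded linear operators, $b\in\mathcal H_d$, and $f,h:\mathcal H_p\to\mathbb R\cup\{+\infty\}$, $g:\mathcal H_v\to\mathbb R\cup\{+\infty\}$ are proper, convex, lower semicontinuous, with $\mathcal C:=\mathrm{dom}(h)$ weakly compact. Primal problem: $\min_{x\in\mathcal H_p}\{f(x)+g(Tx)+h(x):Ax=b\}$. $\Gamma_0(\mathcal H)$ is the set of proper convex lower semicontinuous functions $\mathcal H\to\mathbb R\cup\{+\infty\}$. Lagrangian: $\mathcal L(x,\mu)=f(x)+g(Tx)+h(x)+\langle\mu,Ax-b\rangle$; $(x^\star,\mu^\star)$ is a saddle point if $\mathcal L(x^\star,\mu)\le\mathcal L(x^\star,\mu^\star)\le\mathcal L(x,\mu^\star)$ for all $(x,\mu)$. For $x\in\mathrm{dom}(\partial g)=\{x:\partial g(x)\ne\emptyset\}$, $[\partial g(x)]^0$ is the element of minimal norm of the subdifferential $\partial g(x)$. $\mathrm{ri}$ is the relative interior; $\mathrm{LinHull}(S)$ is the linear subspace parallel to the affine hull of $S$; $A^{-1}(b)$ is the pre-image of $b$ under $A$. $(G,\zeta)$-smoothness: Let $G:\mathcal H\to\mathbb R\cup\{+\infty\}$ and $\zeta:]0,1]\to\mathbb R_+$. A pair $(q,\mathcal C)$ with $q:\mathcal H\to\mathbb R\cup\{+\infty\}$ and $\mathcal C\subset\mathrm{dom}(q)$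 is $(G,\zeta)$-smooth if there is an open set $\mathcal C_0$ with $\mathcal C\subset\mathcal C_0\subset\mathrm{int}(\mathrm{dom}(G))$ such that $G$ and $q$ are differentiable on $\mathcal C_0$, $G-q$ is convex on $\mathcal C_0$, and $K_{(G,\zeta,\mathcal C)}:=\sup\{D_G(z,x)/\zeta(\gamma): x,s\in\mathcal C,\ \gamma\in]0,1],\ z=x+\gamma(s-x)\}<+\infty$, where $D_G(z,x)=G(z)-G(x)-\langle\nabla G(x),z-x\rangle$. Algorithm. Given $x_0\in\mathcal C$, $\mu_0\in\mathrm{ran}(A)$ and non-negative real sequences $(\gamma_k),(\beta_k),(\theta_k),(\rho_k)$ (with $\beta_k>0$), iterate for $k=0,1,2,\dots$: $y_k=\mathrm{prox}_{\beta_kg}(Tx_k)$; $z_k=\nabla f(x_k)+T^*(Tx_k-y_k)/\beta_k+A^*\mu_k+\rho_kA^*(Ax_k-b)$; $s_k\in\mathrm{Argmin}_{s\in\mathcal H_p}\{h(s)+\langle z_k,s\rangle\}$; $x_{k+1}=x_k-\gamma_k(x_k-s_k)$; $\mu_{k+1}=\mu_k+\theta_k(Ax_{k+1}-b)$. Here $\mathrm{prox}_{q}(x)=\mathrm{argmin}_y\{q(y)+\frac12\|x-y\|^2\}$. $\ell^1$ is the space of absolutely summable real sequences and $\ell^1_+$ the set of its non-negative elements. $\mathbb N=\{0,1,2,\dots\}$. *)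

(* Defs.v *)
From HB Require Import structures.
From mathcomp Require Import all_boot all_order all_algebra.
From mathcomp Require Import all_classical all_reals all_analysis.

Set Implicit Arguments.
Unset Strict Implicit.
Unset Printing Implicit Defensive.

Import Order.TTheory GRing.Theory Num.Theory.
Import numFieldNormedType.Exports.

Local Open Scope classical_set_scope.
Local Open Scope ring_scope.

(* Positive definiteness of [inner] follows from [inner_norm]. *)
HB.mixin Record isHilbert (R : realType) H & CompleteNormedModule R H := {
  inner : H -> H -> R ;
  innerC : forall x y, inner x y = inner y x ;
  innerDl : forall x y z, inner (x + y) z = inner x z + inner y z ;
  innerZl : forall a x y, inner (a *: x) y = a * inner x y ;
  inner_norm : forall x, inner x x = `|x| ^+ 2
}.

#[short(type="hilbertType")]
HB.structure Definition Hilbert (R : realType) :=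
  {H of isHilbert R H & CompleteNormedModule R H}.

Section Hilbert_spaces.
Context {R : realType}.

(* The coarsest topology making all the maps [inner u] continuous. *)
Definition weak (H : hilbertType R) : topologicalType :=
  sup_topology (fun u : H => Topological.class
    (initial_topology (fun x : H => inner u x : R^o))).

Definition weakly_compact (H : hilbertType R) (C : set H) : Prop :=
  @compact (weak H) C.

(* Weak convergence in the Hilbert direct sum of [U] and [V], whose weak topology
   is the product of the weak topologies. *)
Definition weakly_cvg_pair (U V : hilbertType R) (w : nat -> U * V) (l : U * V) :
    Prop :=
  w @ \oo --> (l : (weak U * weak V)%type).

Definition bounded_operator (U V : hilbertType R) (A : {linear U -> V}) : Prop :=
  exists M : R, forall x, `|A x| <= M * `|x|.

(* The Hilbert adjoint; unique, and existing (Riesz) when [A] is a bounded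
   linear operator. *)
Definition adjoint (U V : hilbertType R) (A : U -> V) (y : V) : U :=
  xget 0 [set u | forall x, inner (A x) y = inner x u].

Definition orthogonal_complement (H : hilbertType R) (S : set H) : set H :=
  [set u | forall v, S v -> inner u v = 0].

Definition finite_dimensional (V : lmodType R) : Prop :=
  exists (n : nat) (e : 'I_n -> V),
    forall v, exists c : 'I_n -> R, v = \sum_i c i *: e i.

Definition affine_hull (V : lmodType R) (S : set V) : set V :=
  [set x | exists (n : nat) (c : 'I_n -> R) (v : 'I_n -> V),
    [/\ forall i, S (v i), \sum_i c i = 1 & x = \sum_i c i *: v i]].

Definition linear_hull (V : lmodType R) (S : set V) : set V :=
  [set x - y | x in affine_hull S & y in affine_hull S].

Definition relative_interior (H : hilbertType R) (S : set H) : set H :=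
  [set x | affine_hull S x /\ within (affine_hull S) (nbhs x) S].

End Hilbert_spaces.

(* Functions into the reals extended by +oo are maps [q : H -> \bar R] such that
   [-oo < q x] everywhere. *)
Section Extended_real_functions.
Context {R : realType} {H : hilbertType R}.
Implicit Types (q : H -> \bar R) (D : set H).
Local Open Scope ereal_scope.

Definition dom q : set H := [set x | q x < +oo].

(* [D] need not be convex: the inequality is required on the segments
   contained in [D]. *)
Definition convex_on D q : Prop :=
  forall (x y : H) (t : R), (0 < t < 1)%R ->
    (forall s : R, (0 <= s <= 1)%R -> D (s *: x + (1 - s) *: y)%R) ->
    q (t *: x + (1 - t) *: y)%R <= t%:E * q x + (1 - t)%:E * q y.

Record Gamma0 q : Prop := {
  Gamma0_gtNy : forall x, -oo < q x ;
  Gamma0_dom : dom q !=set0 ;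
  Gamma0_convex : convex_on setT q ;
  Gamma0_lsc : lower_semicontinuous q
}.

Definition argmin q : set H := [set x | forall y, q x <= q y].

(* The minimizer is unique when [q] is in [Gamma0]. *)
Definition prox q (x : H) : H :=
  xget 0%R (argmin (fun y => q y + (2^-1 * `|x - y| ^+ 2)%:E)).

Definition subdiff q (x : H) : set H :=
  [set u | forall y, q x + (inner u (y - x)%R)%:E <= q y].

Definition dom_subdiff q : set H := [set x | subdiff q x !=set0].

Definition min_subgrad q (x : H) : H :=
  xget 0%R [set u | subdiff q x u /\
    forall v, subdiff q x v -> (`|u| <= `|v|)%R].

(* Frechet differentiability; [q] takes real values on [D]. *)
Definition differentiable_on D q : Prop :=
  forall x, D x ->
    q x \is a fin_num /\ differentiable (fun y : H => fine (q y) : R^o) x.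

Definition grad q (x : H) : H :=
  xget 0%R [set u | forall v,
    'd (fun y : H => fine (q y) : R^o) x v = inner u v].

Definition bregman q (z x : H) : \bar R :=
  q z - q x - (inner (grad q x) (z - x)%R)%:E.

(* The quotient is the one of extended reals: a positive divergence divided by
   [zeta gamma = 0] is +oo. *)
Definition smooth_constant (G : H -> \bar R) (zeta : R -> R) (C : set H) :
    \bar R :=
  ereal_sup [set r | exists (x s : H) (gamma : R),
    [/\ C x, C s, (0 < gamma <= 1)%R &
        r = bregman G (x + gamma *: (s - x))%R x / (zeta gamma)%:E]].

Definition pair_smooth (G : H -> \bar R) (zeta : R -> R) q (C : set H) : Prop :=
  [/\ forall x, -oo < G x,
      forall gamma : R, (0 < gamma <= 1)%R -> (0 <= zeta gamma)%R,
      C `<=` dom q,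
      (exists C0 : set H,
        [/\ open C0, C `<=` C0, C0 `<=` interior (dom G),
            differentiable_on C0 G /\ differentiable_on C0 q &
            convex_on C0 (fun x => G x - q x)])
    & smooth_constant G zeta C < +oo].

End Extended_real_functions.

Section Problem.
Context {R : realType} {Hp Hd Hv : hilbertType R}.
Variables (f : Hp -> \bar R) (g : Hv -> \bar R) (h : Hp -> \bar R).
Variables (T : Hp -> Hv) (A : Hp -> Hd) (b : Hd).
Local Open Scope ereal_scope.

Definition primal_objective (x : Hp) : \bar R := f x + g (T x) + h x.

Definition primal_solutions : set Hp :=
  [set x | A x = b /\
    forall y, A y = b -> primal_objective x <= primal_objective y].

Definition lagrangian (x : Hp) (mu : Hd) : \bar R :=
  f x + g (T x) + h x + (inner mu (A x - b)%R)%:E.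

Definition saddle_point (xs : Hp) (mus : Hd) : Prop :=
  forall x mu, lagrangian xs mu <= lagrangian xs mus /\
               lagrangian xs mus <= lagrangian x mus.

Record algorithm_run (gamma beta theta rho : nat -> R)
    (x : nat -> Hp) (y : nat -> Hv) (z s : nat -> Hp) (mu : nat -> Hd) : Prop := {
  run_x0 : dom h (x 0%N) ;
  run_mu0 : range A (mu 0%N) ;
  run_y : forall k, y k = prox (fun v => (beta k)%:E * g v) (T (x k)) ;
  run_z : forall k, z k =
    (grad f (x k) + (beta k)^-1 *: adjoint T (T (x k) - y k)
     + adjoint A (mu k) + rho k *: adjoint A (A (x k) - b))%R ;
  run_s : forall k, argmin (fun v => h v + (inner (z k) v)%:E) (s k) ;
  run_x : forall k, x k.+1 = (x k - gamma k *: (x k - s k))%R ;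
  run_mu : forall k, mu k.+1 = (mu k + theta k *: (A (x k.+1) - b))%R
}.

End Problem.

Definition ell1 {R : realType} : set (nat -> R) :=
  [set u : nat -> R | cvgn (series (fun k => `|u k|))].

Definition ell1_nneg {R : realType} : set (nat -> R) :=
  [set u | ell1 u /\ forall k, 0 <= u k].

(* Main.v *)
Require Import Defs.
From mathcomp Require Import all_boot all_order all_algebra.
From mathcomp Require Import all_classical all_reals all_analysis.
From mathcomp Require Import ring lra.

Set Implicit Arguments.
Unset Strict Implicit.
Unset Printing Implicit Defensive.

Import Order.TTheory GRing.Theory Num.Theory.
Import numFieldNormedType.Exports.

Local Open Scope classical_set_scope.
Local Open Scope ring_scope.

(** The Lyapunov argument. Let r_k = A x_k - b, let mu* be a dual solution and
    let p be the optimal value. The potential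
      V_k = f(x_k) + g_k(T x_k) + h(x_k) + <mu_k, r_k> + rho_k / 2 |r_k|^2 - p,
    with g_k the Moreau envelope of g of parameter beta_k, satisfies for every
    w in dom h, with W = A w - b and summable errors eps_k,
      V_{k+1} <= (1 - gamma_k) V_k + gamma_k (Phi(w) - p + <mu_k, W>
        + rho_k / 2 (2 <W, r_k> - |r_k|^2)) + gamma_k / c |r_{k+1}|^2 + eps_k,
    and V_k >= <mu_k - mu*, r_k> + rho_k / 2 |r_k|^2 - O(beta_k).
    Since gamma_k <mu_k - mu*, r_{k+1}> is, up to O(gamma_k^2), the increment of
    c / 2 |mu_k - mu*|^2, the case w = x* shows that V_k + c / 2 |mu_k - mu*|^2
    decreases up to summable errors, by at least a multiple of gamma_k |r_k|^2.
    Hence mu_k is bounded, r_k -> 0, V_k -> 0 and |mu_k - mu*| converges for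
    every dual solution mu*. For general w the inequality then forces
    liminf Phi(w) - p + <mu_k, W> >= 0, so the weak limit points of mu_k are dual
    solutions and Opial's argument yields its weak convergence. The weak limit
    points of x_k lie in the closed convex sets {Phi <= p + e} and
    {|A x - b| <= e}, hence are primal solutions. *)

(** * Real sequences *)

Section Real_sequences.
Context {R : realType}.
Implicit Types (u v w e ga al : nat -> R).

Lemma seriesSr u n : series u n.+1 = series u n + u n.
Proof. by rewrite !seriesEnat/= big_nat_recr. Qed.

Lemma series_ge0 u n : (forall k, 0 <= u k) -> 0 <= series u n.
Proof. by move=> u0; apply: sumr_ge0. Qed.

Lemma series_le_limn u n : (forall k, 0 <= u k) -> cvgn (series u) ->
  series u n <= limn (series u).
Proof.
by move=> u0 cu; apply: nondecreasing_cvgn_le => //; exact: nondecreasing_series.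
Qed.

Lemma bounded_series_cvgn u B : (forall k, 0 <= u k) ->
  (forall n, series u n <= B) -> cvgn (series u).
Proof.
move=> u0 uB; apply: nondecreasing_is_cvgn; first exact: nondecreasing_series.
by exists B => _ [n _ <-].
Qed.

(** Subtracting the accumulated errors makes [u] nonincreasing and bounded below by
    [- limn (series e)], so [u] converges. Telescoping bounds the partial sums of [w] by [u 0] plus
    the total error. *)
Lemma quasi_descent u w e :
  (forall k, 0 <= u k) -> (forall k, 0 <= w k) -> (forall k, 0 <= e k) ->
  cvgn (series e) -> (forall k, u k.+1 <= u k - w k + e k) ->
  cvgn u /\ cvgn (series w).
Proof.
move=> u0 w0 e0 ce de; split; last first.
  apply: (@bounded_series_cvgn w (u 0%N + limn (series e))) => // n.
  have /(_ n) : forall k, series w k <= u 0%N + series e k - u k.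
    elim=> [|k IH]; first by rewrite !seriesEnat/= !big_geq//; lra.
    by rewrite !seriesSr; have := de k; lra.
  by have := series_le_limn n e0 ce; have := u0 n; lra.
have cq : cvgn (u - series e).
  apply: nonincreasing_is_cvgn.
    apply/nonincreasing_seqP => n; rewrite /= !fctE seriesSr.
    by have := de n; have := w0 n; lra.
  exists (- limn (series e)) => _ [n _ <-]; rewrite !fctE.
  by have := series_le_limn n e0 ce; have := u0 n; lra.
rewrite (_ : u = (u - series e) + series e); last by rewrite subrK.
exact: is_cvgD.
Qed.

(** A discrete Gronwall argument: the factors [1 + al k] are at most [expR (al k)], so their
    products stay bounded and [u] has a bound [B]. The term [al k * u k] is then a summable error
    [B * al k], which reduces the claim to [quasi_descent]. *)
Lemma quasi_descent_mul u w e al :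
  (forall k, 0 <= u k) -> (forall k, 0 <= w k) -> (forall k, 0 <= e k) ->
  (forall k, 0 <= al k) -> cvgn (series e) -> cvgn (series al) ->
  (forall k, u k.+1 <= (1 + al k) * u k - w k + e k) ->
  cvgn u /\ cvgn (series w).
Proof.
move=> u0 w0 e0 al0 ce cal de.
pose B := (u 0%N + limn (series e)) * expR (limn (series al)).
have ub k : u k <= B.
  apply: (@le_trans _ _ ((u 0%N + series e k) * expR (series al k))).
    elim: k => [|k IH].
      by rewrite !seriesEnat/= !big_geq// expR0; lra.
    rewrite !seriesSr expRD.
    have h1 : u k * (1 + al k) <=
        (u 0%N + series e k) * expR (series al k) * expR (al k).
      apply: ler_pM => //; first by rewrite addr_ge0.
      exact: expR_ge1Dx.
    have h2 : e k <= e k * (expR (series al k) * expR (al k)).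
      rewrite -[leLHS]mulr1 ler_wpM2l// -expRD -expR0 ler_expR.
      by rewrite addr_ge0// series_ge0.
    by have := de k; have := w0 k; nra.
  apply: ler_pM; rewrite ?expR_ge0 ?addr_ge0 ?series_ge0 ?lerD2l ?ler_expR//;
    exact: series_le_limn.
have B0 : 0 <= B := le_trans (u0 0%N) (ub 0%N).
apply: (@quasi_descent u w (e + B *: al)) => //.
- by move=> k; rewrite !fctE addr_ge0// mulr_ge0.
- by apply: is_cvg_seriesD => //; exact: is_cvg_seriesZ.
- move=> k; rewrite !fctE; have := de k; have := ub k; have := al0 k.
  rewrite /GRing.scale/=; nra.
Qed.

(** A positive limit would keep [u] above half of it eventually, so that a multiple of the series of
    [ga * u] would dominate a tail of the series of [ga]. *)
Lemma cvgn0_of_weighted u ga :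
  (forall k, 0 <= u k) -> (forall k, 0 <= ga k) -> cvgn u ->
  cvgn (series (fun k => ga k * u k)) -> ~ cvgn (series ga) -> u @ \oo --> 0.
Proof.
move=> u0 ga0 cu cgu ncg.
have [<-//|/eqP l0] := pselect (limn u = 0).
have lgt0 : 0 < limn u.
  rewrite lt0r l0/=; apply: limr_ge => //; exact: nearW.
exfalso; apply: ncg.
have : \forall n \near \oo, limn u / 2 < u n.
  by move/cvgrPdist_lt : cu => /(_ (limn u / 2)) []; [lra|] => N _ h;
    exists N => // n /h; rewrite ltr_norml => /andP[]; lra.
move=> [N _ hN].
rewrite -(is_cvg_series_restrict N).
apply: nondecreasing_is_cvgn.
  apply/nondecreasing_seqP => n /=; case: (leqP N n) => Nn.
    by rewrite big_nat_recr//= lerDl.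
  by rewrite !big_geq// ltnW.
have cu0 k : 0 <= ga k * u k by rewrite mulr_ge0.
exists (2 / limn u * limn (series (fun k => ga k * u k))) => _ [n _ <-].
case: (leqP N n) => Nn; last first.
  rewrite /= big_geq ?(ltnW Nn)// mulr_ge0 ?divr_ge0 ?(ltW lgt0)//.
  by apply: (le_trans _ (series_le_limn 0 cu0 cgu)); exact: series_ge0.
apply: (@le_trans _ _ (2 / limn u * \sum_(N <= k < n) (ga k * u k))).
  rewrite mulr_sumr /=; apply: ler_sum_nat => k /andP[Nk _]; rewrite mulrCA ler_peMr//.
  by rewrite mulrAC ler_pdivlMr// mul1r; have := hN _ Nk; lra.
rewrite ler_wpM2l ?divr_ge0 ?(ltW lgt0)//.
apply: le_trans (series_le_limn n cu0 cgu).
by rewrite seriesEnat/= [leRHS](big_cat_nat (n := N))//= lerDr sumr_ge0.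
Qed.

Lemma cvgn0_of_quasi_contraction u ga e :
  (forall k, 0 <= u k) -> (forall k, 0 <= ga k) -> (forall k, 0 <= e k) ->
  cvgn (series e) -> ~ cvgn (series ga) ->
  (forall k, u k.+1 <= (1 - ga k) * u k + e k) -> u @ \oo --> 0.
Proof.
move=> u0 ga0 e0 ce ncg de.
have gu0 k : 0 <= ga k * u k by rewrite mulr_ge0.
have [|cu cg] := quasi_descent u0 gu0 e0 ce.
  by move=> k; have := de k; lra.
exact: cvgn0_of_weighted cg ncg.
Qed.

(* The squares satisfy a quasi-descent inequality with summable error
   [2 C ga u + C ^ 2 ga ^ 2], hence converge. *)
Lemma cvgn0_of_slow_variation u ga C : 0 <= C ->
  (forall k, 0 <= u k) -> (forall k, 0 <= ga k) ->
  (forall k, u k.+1 <= u k + C * ga k) ->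
  cvgn (series (fun k => ga k ^+ 2)) -> ~ cvgn (series ga) ->
  cvgn (series (fun k => ga k * u k)) -> u @ \oo --> 0.
Proof.
move=> C0 u0 ga0 du cg2 ncg cgu.
pose e := C * 2 *: (fun k => ga k * u k) + C ^+ 2 *: (fun k => ga k ^+ 2).
have e0 k : 0 <= e k.
  by rewrite /e !fctE /GRing.scale/= addr_ge0// mulr_ge0 ?sqr_ge0 ?mulr_ge0.
have ce : cvgn (series e) by apply: is_cvg_seriesD; apply: is_cvg_seriesZ.
have u20 k : 0 <= u k ^+ 2 by rewrite sqr_ge0.
have [|c _] := @quasi_descent (fun k => u k ^+ 2) (fun=> 0) e u20 (fun=> lexx 0) e0 ce.
  move=> k; rewrite /e !fctE /GRing.scale/=.
  have : u k.+1 ^+ 2 <= (u k + C * ga k) ^+ 2.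
    by rewrite ler_sqr ?nnegrE// addr_ge0 ?mulr_ge0.
  by nra.
(* A bound [B] on the squares gives the bound [B + 1] on [u], because [u <= u ^+ 2 + 1]. *)
have [B uB] : exists B, forall k, u k <= B.
  have [B hB] := cvg_has_ub c.
  exists (B + 1) => k; have : `|u k ^+ 2| <= B by apply: hB; exists k.
  by rewrite ger0_norm ?sqr_ge0//; have := u0 k; nra.
have B0 : 0 <= B := le_trans (u0 0%N) (uB 0%N).
(* The weighted series of the squares converges since [u ^+ 2 <= B * u]. *)
have cu2 : (fun k => u k ^+ 2) @ \oo --> 0.
  apply: (@cvgn0_of_weighted _ ga) => //.
  apply: (@series_le_cvg _ _ (B *: (fun k => ga k * u k))).
  - by move=> k; rewrite mulr_ge0 ?sqr_ge0.
  - by move=> k; rewrite !fctE /GRing.scale/= !mulr_ge0.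
  - move=> k; rewrite !fctE /GRing.scale/= expr2 mulrA mulrC ler_wpM2r//.
    by rewrite mulr_ge0.
  - exact: is_cvg_seriesZ.
apply/cvgr0Pnorm_lt => d d_gt0.
have e2 : 0 < d ^+ 2 by rewrite exprn_gt0.
move/cvgr0Pnorm_lt : cu2 => /(_ _ e2); apply: filterS => k.
by rewrite !ger0_norm ?sqr_ge0// ltr_sqr ?nnegrE// ltW.
Qed.

(* As long as the accumulated step length [G] is at most 2, [t] stays close to
   [t n]; were [t n < - eta], this would make [V] drop by a fixed amount. *)
Lemma window_lower_bound (V t sg et e ga : nat -> R) :
  (forall k, 0 <= ga k <= 1) -> (forall k, 0 <= e k) ->
  cvgn (series e) -> ~ cvgn (series ga) -> cvgn V ->
  sg @ \oo --> 0 -> et @ \oo --> 0 ->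
  (forall k, t k.+1 <= t k + ga k * sg k) ->
  (forall k, V k.+1 <= V k + ga k * (t k + et k) + e k) ->
  forall eta, 0 < eta -> \forall n \near \oo, - eta <= t n.
Proof.
move=> ga01 e0 ce ncg cV sg0 et0 dt dV eta eta0.
have ga0 k : 0 <= ga k by case/andP: (ga01 k).
(* [Q] absorbs the errors and still converges, so it cannot vary by [eta / 2] between late
   indices. *)
pose Q := V - series e.
have cQ : cvgn Q by apply: is_cvgB.
have dQ k : Q k.+1 <= Q k + ga k * (t k + et k).
  by rewrite /Q !fctE seriesSr; have := dV k; lra.
have q4 : 0 < eta / 4 by rewrite divr_gt0.
have [N1 _ hN1] : \forall n \near \oo, `|sg n| < eta / 4.
  by move/cvgr0Pnorm_lt : sg0; apply.
have [N2 _ hN2] : \forall n \near \oo, `|et n| < eta / 4.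
  by move/cvgr0Pnorm_lt : et0; apply.
have [N3 _ hN3] : \forall n \near \oo, `|limn Q - Q n| < eta / 4.
  by move/cvgrPdist_lt : cQ; apply.
exists (maxn N1 (maxn N2 N3)) => // n.
rewrite /= !geq_max => /and3P[n1 n2 n3].
rewrite leNgt; apply/negP => tn.
(* [G j] plays the role of the time elapsed since index [n]. *)
pose G j := \sum_(n <= i < n + j) ga i.
have GS j : G j.+1 = G j + ga (n + j)%N.
  by rewrite /G addnS big_nat_recr//= leq_addr.
have G0 : G 0%N = 0 by rewrite /G addn0 big_geq.
have Gge0 j : 0 <= G j by apply: sumr_ge0.
have sgn j : sg (n + j)%N < eta / 4.
  by apply: le_lt_trans (ler_norm _) (hN1 _ _); rewrite /= (leq_trans n1)// leq_addr.
have etn j : et (n + j)%N < eta / 4.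
  by apply: le_lt_trans (ler_norm _) (hN2 _ _); rewrite /= (leq_trans n2)// leq_addr.
have tG j : t (n + j)%N <= - eta + eta / 4 * G j.
  elim: j => [|j IH]; first by rewrite addn0 G0; lra.
  rewrite addnS GS; have := dt (n + j)%N; have := sgn j; have := ga0 (n + j)%N.
  by nra.
(* The right-hand side integrates the rate [- eta + eta / 4 * G + eta / 4] in [G]. The discrete sum
   stays below it because squaring [G + x] leaves the surplus [eta / 8 * x ^+ 2]. *)
have QG j : Q (n + j)%N <= Q n - 3 / 4 * eta * G j + eta / 8 * G j ^+ 2.
  elim: j => [|j IH]; first by rewrite addn0 G0; lra.
  rewrite addnS GS; have := dQ (n + j)%N; have := tG j; have := etn j.
  have := ga0 (n + j)%N.
  set x := ga (n + j)%N => x0 etj tj dq.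
  have h1 : x * (t (n + j)%N + et (n + j)%N) <=
            x * (- eta + eta / 4 * G j + eta / 4) by rewrite ler_wpM2l//; lra.
  have h2 : 0 <= eta / 8 * x ^+ 2 by rewrite mulr_ge0 ?sqr_ge0//; lra.
  by nra.
have [j0 hj0] : exists j, 1 < G j.
  apply/not_existsP => nG; apply: ncg.
  rewrite -(is_cvg_series_restrict n).
  apply: nondecreasing_is_cvgn.
    apply/nondecreasing_seqP => k /=; case: (leqP n k) => nk.
      by rewrite big_nat_recr//= lerDl.
    by rewrite !big_geq// ltnW.
  exists 1 => _ [k _ <-]; case: (leqP n k) => nk; last by rewrite /= big_geq// ltnW.
  by have /negP := nG (k - n)%N; rewrite /G subnKC// -leNgt.
(* Since each step is at most 1, the first time that [G] exceeds 1 it is still at most 2. *)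
have ex : exists j, 1 < G j by exists j0.
case: (ex_minnP ex) => -[|j]; first by rewrite G0 ltr10.
move=> Gj1 /(_ j) Gj.
have Gj' : G j <= 1.
  by rewrite leNgt; apply/negP => /Gj; rewrite ltnn.
have Gj2 : G j.+1 <= 2 by rewrite GS; case/andP: (ga01 (n + j)%N); lra.
have := QG j.+1.
have := hN3 n n3; rewrite ltr_norml => /andP[Qn1 Qn2].
have : `|limn Q - Q (n + j.+1)%N| < eta / 4.
  by apply: hN3; rewrite /= (leq_trans n3)// leq_addr.
rewrite ltr_norml => /andP[Qj1 Qj2].
set g := G j.+1 in Gj1 Gj2 *.
(* For [1 <= g <= 2] one has [g ^+ 2 <= 3 * g - 2], so [Q] has dropped by at least [5 / 8 * eta],
   although both of its values are within [eta / 4] of the limit. *)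
have : 0 <= eta * ((g - 1) * (2 - g)) by rewrite !mulr_ge0; lra.
have : 0 <= eta * (g - 1) by rewrite mulr_ge0; lra.
nra.
Qed.

End Real_sequences.

(** * Hilbert spaces *)

(** The first-order condition hidden in a quadratic: divide by [t] and let [t] tend to 0. It yields
    the variational inequalities of the minimizers below. *)
Lemma small_quadratic_ge0 {R : realFieldType} (d n : R) :
  (forall t, 0 < t < 1 -> 0 <= t * d + t ^+ 2 * n) -> 0 <= d.
Proof.
move=> h; rewrite leNgt; apply/negP => d0.
have n0 := normr_ge0 n; have nn := ler_norm n.
have D0 : 0 < - d + `|n| + 1 by lra.
(* For negative [d], this [t] lies in ]0, 1[ and satisfies [t * n < - d]. *)
set t := - d / (- d + `|n| + 1).
have tD : t * (- d + `|n| + 1) = - d by rewrite /t divfK ?gt_eqF.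
have t0 : 0 < t by rewrite divr_gt0//; lra.
have t1 : t < 1 by rewrite ltr_pdivrMr//; lra.
have : 0 <= t * (d + t * n) by have := h t; rewrite t0 t1 => /(_ isT); nra.
rewrite pmulr_rge0//; nra.
Qed.

Section Inner_product.
Context {R : realType} {H : hilbertType R}.
Implicit Types x y z u v w : H.

Lemma innerDr x y z : inner x (y + z) = inner x y + inner x z.
Proof. by rewrite innerC innerDl innerC (innerC z). Qed.

Lemma innerZr a x y : inner x (a *: y) = a * inner x y.
Proof. by rewrite innerC innerZl innerC. Qed.

Lemma innerNl x y : inner (- x) y = - inner x y.
Proof. by rewrite -scaleN1r innerZl mulN1r. Qed.

Lemma innerNr x y : inner x (- y) = - inner x y.
Proof. by rewrite -scaleN1r innerZr mulN1r. Qed.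

Lemma innerBl x y z : inner (x - y) z = inner x z - inner y z.
Proof. by rewrite innerDl innerNl. Qed.

Lemma innerBr x y z : inner x (y - z) = inner x y - inner x z.
Proof. by rewrite innerDr innerNr. Qed.

Lemma inner0l x : inner 0 x = 0.
Proof. by rewrite -(subrr 0) innerBl subrr. Qed.

Lemma inner0r x : inner x 0 = 0.
Proof. by rewrite innerC inner0l. Qed.

End Inner_product.

(** Turns squared norms into inner products and expands by bilinearity. The orientation of the mixed
    products is then fixed by [innerC], so that arithmetic tactics meet matching atoms. *)
Ltac inner_expand := rewrite -?inner_norm
  ?(innerBl, innerBr, innerDl, innerDr, innerNl, innerNr, innerZl, innerZr).

(** * Minimization, projection and weak limits *)

Section Hilbert_geometry.
Context {R : realType} {H : hilbertType R}.
Implicit Types x y z u v w : H.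

Lemma sqr_normD x y : `|x + y| ^+ 2 = `|x| ^+ 2 + 2 * inner x y + `|y| ^+ 2.
Proof. by rewrite -!inner_norm !(innerDl, innerDr) (innerC y x); ring. Qed.

Lemma sqr_normB x y : `|x - y| ^+ 2 = `|x| ^+ 2 - 2 * inner x y + `|y| ^+ 2.
Proof. by rewrite sqr_normD innerNr normrN; ring. Qed.

Lemma sqr_normZ (a : R) x : `|a *: x| ^+ 2 = a ^+ 2 * `|x| ^+ 2.
Proof. by rewrite -!inner_norm innerZl innerZr mulrA expr2. Qed.

Lemma cauchy_schwarz x y : inner x y <= `|x| * `|y|.
Proof.
have [->|x0] := eqVneq x 0; first by rewrite inner0l normr0 mul0r.
have [->|y0] := eqVneq y 0; first by rewrite inner0r normr0 mulr0.
have xy : 0 < `|x| * `|y| by rewrite mulr_gt0 ?normr_gt0.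
have := sqr_ge0 `| `|y| *: x - `|x| *: y|.
rewrite sqr_normB !sqr_normZ innerZl innerZr => h.
rewrite -(ler_pM2l xy); nra.
Qed.

Lemma normr_inner x y : `|inner x y| <= `|x| * `|y|.
Proof.
rewrite ler_norml cauchy_schwarz andbT lerNl -innerNl -(normrN x).
exact: cauchy_schwarz.
Qed.

Lemma inner_continuous v : continuous (fun u => inner u v : R^o).
Proof.
move=> u; apply/cvgrPdist_lt => e e0.
have v1 : 0 < `|v| + 1 by have := normr_ge0 v; lra.
have ev : 0 < e / (`|v| + 1) by rewrite divr_gt0.
have : \forall w \near u, `|u - w| < e / (`|v| + 1).
  by apply: cvgr_dist_lt.
apply: filterS => w; rewrite ltr_pdivlMr// => h; rewrite -innerBl.
by have := normr_inner (u - w) v; have := normr_ge0 (u - w); nra.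
Qed.

(* The sublevel sets of a strongly convex function have vanishing diameter:
   they generate a Cauchy filter, whose limit is the minimizer. *)
Lemma proximal_argmin_nonempty (phi : H -> \bar R) x (m : R) :
  (forall w, -oo < phi w)%E -> dom phi !=set0 -> convex_on setT phi ->
  lower_semicontinuous phi ->
  (forall w, m%:E <= phi w + (2^-1 * `|x - w| ^+ 2)%:E)%E ->
  argmin (fun w => phi w + (2^-1 * `|x - w| ^+ 2)%:E)%E !=set0.
Proof.
move=> phiNy [w0 w0dom] cphi lphi Jm.
set J := (fun w => _).
have JNy w : (-oo < J w)%E by rewrite /J (lt_le_trans _ (Jm w))// ltNyr.
pose inJ := ereal_inf (range J).
have inJ_fin : inJ \is a fin_num.
  rewrite fin_numE; apply/andP; split.
    rewrite -ltNye (@lt_le_trans _ _ m%:E)// ?ltNyr//.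
    by apply: le_ereal_inf_tmp => _ [w _ <-]; exact: Jm.
  rewrite -ltey (@le_lt_trans _ _ (J w0))//.
    by apply: ereal_inf_lbound; exists w0.
  by rewrite /J lte_add_pinfty ?ltry.
pose r := fine inJ.
have rE : r%:E = inJ by rewrite /r fineK.
have rJ w : (r%:E <= J w)%E by rewrite rE; apply: ereal_inf_lbound; exists w.
pose S (e : R) := [set w | (J w <= (r + e)%:E)%E].
have S0 e : 0 < e -> S e !=set0.
  move=> e0; have /ereal_inf_lt[_ [w _ <-] /ltW Jw] : (inJ < (r + e)%:E)%E.
    by rewrite -rE lte_fin; lra.
  by exists w.
have finphi e w : S e w -> exists2 p : R, phi w = p%:E &
    p + 2^-1 * `|x - w| ^+ 2 <= r + e.
  rewrite /S/= /J; case: (phi w) (phiNy w) => // p _ h; exists p => //.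
have Sd e w w' : S e w -> S e w' -> `|w - w'| ^+ 2 <= 8 * e.
  move=> /finphi[p pE hp] /finphi[p' p'E hp'].
  have half01 : 0 < (2^-1 : R) < 1 by lra.
  have := cphi w w' 2^-1 half01 (fun _ _ => I).
  have := rJ (2^-1 *: w + (1 - 2^-1) *: w').
  rewrite /J pE p'E.
  set c := 2^-1 *: w + _.
  case: (phi c) (phiNy c) => // pc _; rewrite -!EFinM -!EFinD !lee_fin.
  move: hp hp'; rewrite /c; inner_expand.
  rewrite (innerC w x) (innerC w' x) (innerC w' w); lra.
pose F := filter_from [set e : R | 0 < e] S.
have FF : ProperFilter F.
  apply: filter_from_proper; last by move=> e /S0.
  apply: filter_from_filter; first by exists 1 => /=.
  move=> e e' /= e0 e'0; exists (Num.min e e'); first by rewrite /= lt_min e0.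
  by move=> w Sw; split; apply: le_trans Sw _; rewrite lee_fin lerD2l ge_min lexx ?orbT.
have : cvg F.
  apply: cauchy_cvg; apply: cauchy_exP => e /= e0.
  have d0 : 0 < e ^+ 2 / 16 by rewrite divr_gt0 ?exprn_gt0.
  have [w Sw] := S0 _ d0; exists w; exists (e ^+ 2 / 16) => // w' Sw'.
  rewrite -ball_normE /ball_/= -(ltr_sqr) ?nnegrE ?(ltW e0)//.
  by apply: le_lt_trans (Sd _ _ _ Sw Sw') _; have := exprn_gt0 2 e0; lra.
move=> /cvg_ex[p Fp]; exists p => w.
apply: le_trans (rJ w); rewrite leNgt; apply/negP => rJp.
set q := 2^-1 * `|x - p| ^+ 2.
(* If [J p] exceeded [r], then near [p] lower semicontinuity would keep [phi] above [r - q + 2 * d]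
   and continuity the quadratic term above [q - d]. Points of [S d] near [p] contradict this. *)
have [d d0 hd] : exists2 d, 0 < d & ((r - q + 2 * d)%:E < phi p)%E.
  move: rJp; rewrite /J -/q; case: (phi p) (phiNy p) => // [a _|_ _].
    rewrite -EFinD lte_fin => h; exists ((a - (r - q)) / 3); first by lra.
    by rewrite lte_fin; lra.
  by exists 1; rewrite ?ltry.
have [V pV hV] := lphi p _ hd.
have qV : \forall w \near p, q - d < 2^-1 * `|x - w| ^+ 2.
  have : (fun w => 2^-1 * `|x - w| ^+ 2) w @[w --> p] --> q.
    apply: cvgM; first exact: cvg_cst.
    rewrite /q; under eq_fun do rewrite expr2.
    rewrite expr2; apply: cvgM; apply: cvg_norm; apply: cvgB => //;
      exact: cvg_cst.
  by move/cvgrPdist_lt => /(_ _ d0); apply: filterS => y; rewrite ltr_norml => /andP[]; lra.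
have FS : F (S d) by exists d.
have /filter_ex[y [[Vy qy] Sy]] : F ((V `&` [set w | q - d < 2^-1 * `|x - w| ^+ 2]) `&` S d).
  by apply: filterI => //; apply: filterI; apply: Fp.
have := hV y Vy; have [a -> ha] := finphi _ _ Sy; rewrite lte_fin.
move: qy => /=; lra.
Qed.

(** The representing vector is the minimizer of half the squared norm minus [l]. Its first-order
    condition in the directions [v] and [- v] gives the equality. *)
Lemma riesz (l : H -> R) (M : R) :
  (forall x y, l (x + y) = l x + l y) -> (forall a x, l (a *: x) = a * l x) ->
  (forall x, `|l x| <= M * `|x|) -> exists u, forall v, l v = inner u v.
Proof.
move=> lD lZ lM.
have lN x : l (- x) = - l x by rewrite -scaleN1r lZ mulN1r.
have [u hu] :
    argmin (fun w => (- l w)%:E + (2^-1 * `|0 - w| ^+ 2)%:E)%E !=set0.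
  apply: (@proximal_argmin_nonempty _ _ (- (2^-1 * M ^+ 2))).
  - by move=> w; rewrite ltNyr.
  - by exists 0; rewrite /dom/= ltry.
  - move=> x y t _ _; rewrite -!EFinM -EFinD lee_fin lD !lZ; lra.
  - move=> x a; rewrite lte_fin => hx.
    have M1 : 0 < `|M| + 1 by have := normr_ge0 M; lra.
    exists (ball x ((- l x - a) / (`|M| + 1))).
      by apply: nbhsx_ballx; rewrite divr_gt0// subr_gt0.
    move=> y; rewrite -ball_normE/= ltr_pdivlMr// => hy.
    rewrite lte_fin.
    have h := lM (y - x); rewrite lD lN ler_norml distrC in h.
    have : M * `|x - y| <= `|M| * `|x - y| by rewrite ler_wpM2r// ler_norm.
    have := normr_ge0 (x - y); case/andP: h; nra.
  - move=> w; rewrite -EFinD lee_fin sub0r normrN.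
    have := lM w; rewrite ler_norml => /andP[_].
    by have := sqr_ge0 (M - `|w|); nra.
have key v : l v <= inner u v.
  rewrite -subr_ge0; apply: (@small_quadratic_ge0 _ _ (2^-1 * `|v| ^+ 2)) => t _.
  have := hu (u + t *: v).
  rewrite -!EFinD lee_fin !sub0r !normrN sqr_normD sqr_normZ innerZr lD lZ; lra.
exists u => v; apply/eqP; rewrite eq_le key/= -lerN2 -innerNr -lN; exact: key.
Qed.

(** The projection is the proximal point of the indicator function of [K]. Comparing it with the
    points of the segment towards [y] gives the variational inequality. *)
Lemma nearest_point (K : set H) x : closed K -> K !=set0 ->
  (forall y z t, K y -> K z -> 0 < t < 1 -> K (t *: y + (1 - t) *: z)) ->
  exists2 p, K p & forall y, K y -> inner (x - p) (y - p) <= 0.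
Proof.
move=> clK [w0 Kw0] convK.
pose phi w : \bar R := if w \in K then 0%E else +oo%E.
have phiK w : K w -> phi w = 0%E by rewrite /phi => Kw; rewrite mem_set.
have phiNK w : ~ K w -> phi w = +oo%E by rewrite /phi => Kw; rewrite memNset.
have [p hp] : argmin (fun w => phi w + (2^-1 * `|x - w| ^+ 2)%:E)%E !=set0.
  apply: (@proximal_argmin_nonempty _ _ 0).
  - by move=> w; rewrite /phi; case: ifP.
  - by exists w0; rewrite /dom/= phiK.
  - move=> y z t t01 _; have /andP[t0 t1] := t01.
    have t1' : 0 < 1 - t by rewrite subr_gt0.
    have ty : (t%:E * +oo = +oo)%E by rewrite gt0_muley ?lte_fin.
    have ty' : ((1 - t)%:E * +oo = +oo)%E by rewrite gt0_muley ?lte_fin.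
    have [Ky|Ky] := pselect (K y); have [Kz|Kz] := pselect (K z).
    + rewrite (phiK y Ky) (phiK z Kz) !mule0 adde0 phiK//; exact: convK.
    + by rewrite (phiK y Ky) (phiNK z Kz) mule0 add0e ty' leey.
    + by rewrite (phiNK y Ky) (phiK z Kz) mule0 adde0 ty leey.
    + by rewrite (phiNK y Ky) (phiNK z Kz) ty ty' addye// leey.
  - move=> y a; have [Ky|Ky] := pselect (K y).
      rewrite phiK// => a0; exists setT; first exact: filterT.
      by move=> z _; rewrite (lt_le_trans a0)// /phi; case: ifP.
    move=> _; exists (~` K); last by move=> z /phiNK ->; rewrite ltry.
    by apply: open_nbhs_nbhs; split => //; exact: closed_openC.
  - move=> w; rewrite /phi; case: ifP => _; last by rewrite addye// leey.
    by rewrite add0e lee_fin mulr_ge0// ?sqr_ge0// invr_ge0.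
have Kp : K p.
  apply/not_notP => nKp; have := hp w0.
  by rewrite phiNK// phiK// addye// add0e leye_eq.
exists p => // y Ky; rewrite -oppr_ge0.
apply: (@small_quadratic_ge0 _ _ (2^-1 * `|y - p| ^+ 2)) => t t01.
have Kt := convK _ _ _ Ky Kp t01; have := hp (t *: y + (1 - t) *: p).
rewrite !phiK// !add0e lee_fin; inner_expand.
rewrite (innerC p x) (innerC y x) (innerC y p); nra.
Qed.

(* Otherwise the functional [q - p], with [p] the point of [K] nearest to [q],
   would separate [q] from [K]. *)
Lemma weak_limit_closed_convex (U : set_system nat) (w : nat -> H) (q : H)
    (K : set H) : ProperFilter U -> closed K ->
  (forall y z t, K y -> K z -> 0 < t < 1 -> K (t *: y + (1 - t) *: z)) ->
  (forall u, inner u (w n) @[n --> U] --> inner u q) ->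
  (\forall n \near U, K (w n)) -> K q.
Proof.
move=> UF clK convK wq Kw.
have [n Kn] := filter_ex Kw.
have [|p Kp hp] := nearest_point q clK _ convK; first by exists (w n).
suff -> : q = p by [].
apply/eqP; rewrite -subr_eq0 -normr_eq0 -sqrf_eq0 -inner_norm; apply/eqP.
apply: le_anti; rewrite inner_norm sqr_ge0 andbT -inner_norm innerBr subr_le0.
apply: (cvgr_to_le (wq (q - p))).
by apply: filterS Kw => k /hp; rewrite innerBr subr_le0.
Qed.

Lemma ultra_fmap (S T : Type) (f : S -> T) (U : set_system S) :
  UltraFilter U -> UltraFilter (f @ U).
Proof.
move=> UU; split; first exact: fmap_proper_filter.
move=> G GF UG; apply/seteqP; split => // A GA.
have [//|UnA] := in_ultra_setVsetC (f @^-1` A) UU.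
have GnA : G (~` A) by exact: UG.
have : G (A `&` ~` A) by exact: filterI.
by rewrite setICr => /filter_ex[].
Qed.

Lemma ultra_bounded_cvg (U : set_system nat) (a : nat -> R) (B : R) :
  UltraFilter U -> (forall n, `|a n| <= B) -> cvg (a @ U).
Proof.
move=> UU aB.
have aU : U (a @^-1` `[- B, B]%classic).
  by apply: filterE => n; rewrite /= in_itv/= -ler_norml.
have := @segment_compact R (- B) B; rewrite compact_ultra.
by move=> /(_ _ (ultra_fmap a UU) aU)[l [_ ?]]; apply/cvg_ex; exists l.
Qed.

(* Ultrafilters play the role of weakly convergent subsequences. *)
Lemma ultra_weak_limit (U : set_system nat) (w : nat -> H) (B : R) :
  UltraFilter U -> (forall n, `|w n| <= B) ->
  exists q, forall u, inner u (w n) @[n --> U] --> inner u q.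
Proof.
move=> UU wB.
have uB u n : `|inner u (w n)| <= B * `|u|.
  by apply: le_trans (normr_inner _ _) _; rewrite mulrC ler_wpM2r.
have cu u : cvg (inner u (w n) @[n --> U]) by exact: ultra_bounded_cvg (uB u).
(* The limits along [U] form a bounded linear functional of [u], and its Riesz vector is the weak
   limit. *)
pose l u := lim (inner u (w n) @[n --> U]).
have [||u|q hq] := @riesz l B.
- move=> x y; rewrite /l; under eq_fun do rewrite innerDl; exact: limD.
- move=> a x; rewrite /l; under eq_fun do rewrite innerZl.
  by apply: cvg_lim => //; apply: cvgM; [exact: cvg_cst|exact: cu].
- apply: (@cvgr_to_le _ U _ _ (fun n => `|inner u (w n)|)).
    by apply: cvg_norm; exact: cu.
  exact: filterE.
- by exists q => u; rewrite (innerC u q) -hq; exact: cu.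
Qed.

(** Stands for the extraction of the subsequence with indices in [P]. *)
Lemma subseq_filter_proper (P : set nat) : ~ (\forall n \near \oo, ~ P n) ->
  ProperFilter (within P \oo).
Proof.
move=> nP; apply: Build_ProperFilter_ex.
move=> A AP; apply/not_existsP => nA; apply: nP.
have AP' : \oo [set n | P n -> A n] := AP.
by apply: filterS AP' => n hn /hn An; exact: (nA n An).
Qed.

(** If some [inner u (w n)] stayed away from [inner u p] for infinitely many [n], an ultrafilter
    concentrated on these indices would have a weak limit, necessarily [p], which is absurd. *)
Lemma weak_cvg_of_unique_limit (w : nat -> H) (B : R) (p : H) :
  (forall n, `|w n| <= B) ->
  (forall (U : set_system nat) q, UltraFilter U -> \oo `<=` U ->
    (forall u, inner u (w n) @[n --> U] --> inner u q) -> q = p) ->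
  forall u, inner u (w n) @[n --> \oo] --> inner u p.
Proof.
move=> wB uniq u; apply/cvgrPdist_lt => e e0.
pose P : set nat := [set n | e <= `|inner u p - inner u (w n)|].
apply/not_notP => nP.
have PP : ProperFilter (within P \oo).
  apply: subseq_filter_proper => hP; apply: nP; apply: filterS hP => n /negP.
  by rewrite -ltNge.
have [U [UU PU]] := ultraFilterLemma PP.
have ooU : \oo `<=` U by move=> A hA; apply: PU; exact: filterS hA.
have [q hq] := ultra_weak_limit UU wB.
have qp := uniq _ _ UU ooU hq.
have UP : U P by apply: PU; exact: withinT.
have : U (P `&` [set n | `|inner u p - inner u (w n)| < e]).
  apply: filterI => //.
  by have := hq u; rewrite qp => /cvgrPdist_lt; exact.
by move=> /filter_ex[n []]; rewrite /P/= leNgt => /negP.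
Qed.

Lemma weakly_cvg (w : nat -> H) (p : H) :
  (forall u, inner u (w n) @[n --> \oo] --> inner u p) ->
  w @ \oo --> (p : weak H).
Proof.
move=> wp; apply/cvg_sup => u A [_ [[B oB <-] Bp sBA]].
have wB : \oo (fun n => B (inner u (w n))).
  exact: (wp u B (open_nbhs_nbhs (conj oB Bp))).
suff : \oo (w @^-1` A) by [].
by apply: filterS wB => n; exact: sBA.
Qed.

(** Each [inner u] is weakly continuous, hence bounded on [C]. The functionals [inner x] for [x] in
    [C] are thus pointwise bounded, and the uniform boundedness principle applies. *)
Lemma weakly_compact_bounded (C : set H) : weakly_compact C ->
  exists2 B, 0 <= B & forall x, C x -> `|x| <= B.
Proof.
move=> cC.
have ptw u : exists M : R, forall x, C x -> `|inner u x| <= M.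
  have cont : continuous (fun x : weak H => inner u x : R^o).
    move=> x A fA.
    have xx : nbhs (x : weak H) --> (x : weak H) by [].
    move/cvg_sup : xx => /(_ u); apply.
    exact: (@initial_continuous _ _ (fun x : H => inner u x : R^o)).
  have /compact_bounded[M [_ hM]] : compact ((fun x : weak H => inner u x : R^o) @` C).
    by apply: continuous_compact cC; exact: continuous_subspaceT.
  exists (M + 1) => x Cx; apply: (hM (M + 1)); first by rewrite ltrDl.
  by exists x.
pose F : set (H -> R^o) := [set l | exists2 x, C x & l = inner x].
have [||M hM] := @Banach_Steinhauss R H R^o F _ _ 1.
- move=> _ [x Cx ->]; split.
    move=> r; exists (`|x| * r) => y yr.
    by apply: le_trans (normr_inner _ _) _; rewrite ler_wpM2l.
  by move=> a y z; rewrite innerDr innerZr.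
- move=> u; have [M hM] := ptw u; exists M => _ [x Cx ->]; rewrite innerC.
  exact: hM.
exists (Num.max M 0); first by rewrite le_max lexx orbT.
move=> x Cx; rewrite le_max.
have [->|x0] := eqVneq x 0; first by rewrite normr0 lexx orbT.
(* At the normalized vector, the functional [inner x] takes the value of the norm of [x]. *)
have := hM (inner x) (ex_intro2 _ _ x Cx erefl) (`|x|^-1 *: x).
rewrite normrZ normfV normr_id mulVf ?normr_eq0// lexx => /(_ isT).
rewrite innerZr inner_norm expr2 mulrA mulVf ?normr_eq0// mul1r normr_id.
by move=> ->.
Qed.

End Hilbert_geometry.

(** For two weak limit points [p] and [q], the difference of the squared distances to them converges
    along the whole sequence, hence so does [inner (p - q) (w n)]. Evaluating its limit along the
    two ultrafilters gives [inner (p - q) p = inner (p - q) q], that is, [p = q]. *)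
Lemma opial (R : realType) (H : hilbertType R) (w : nat -> H) (B : R) (S : set H) :
  (forall n, `|w n| <= B) ->
  (forall p, S p -> cvgn (fun n => `|w n - p| ^+ 2)) ->
  (forall (U : set_system nat) q, UltraFilter U -> \oo `<=` U ->
    (forall u, inner u (w n) @[n --> U] --> inner u q) -> S q) ->
  exists2 p, S p & forall u, inner u (w n) @[n --> \oo] --> inner u p.
Proof.
move=> wB cS limS.
have [U0 [UU0 oU0]] := ultraFilterLemma (eventually_filter : ProperFilter \oo).
have [p hp] := ultra_weak_limit UU0 wB.
have Sp := limS _ _ UU0 oU0 hp; exists p => //.
apply: (weak_cvg_of_unique_limit wB) => U q UU oU hq.
have Sq := limS _ _ UU oU hq.
have [l hl] : exists l, inner (p - q) (w n) @[n --> \oo] --> (l : R).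
  have c1 := cS _ Sp; have c2 := cS _ Sq.
  exists ((limn (fun n => `|w n - q| ^+ 2) - limn (fun n => `|w n - p| ^+ 2)
     + (`|p| ^+ 2 - `|q| ^+ 2)) * 2^-1).
  rewrite (_ : (fun n => _) = (fun n => (`|w n - q| ^+ 2 - `|w n - p| ^+ 2
     + (`|p| ^+ 2 - `|q| ^+ 2)) * 2^-1)); last first.
    by apply/funext => n; rewrite !sqr_normB innerBl !(innerC _ (w n)); field.
  by apply: cvgM; [apply: cvgD; [exact: cvgB|exact: cvg_cst]|exact: cvg_cst].
have l0 : l = inner (p - q) p.
  apply: (@cvg_unique R^o _ (inner (p - q) (w n) @[n --> U0])) => //; last exact: hp.
  by move=> V /hl /oU0.
have l1 : l = inner (p - q) q.
  apply: (@cvg_unique R^o _ (inner (p - q) (w n) @[n --> U])) => //; last exact: hq.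
  by move=> V /hl /oU.
apply/esym/eqP; rewrite -subr_eq0 -normr_eq0 -sqrf_eq0 -inner_norm innerBr -l0 -l1.
by rewrite subrr.
Qed.

(** * Convex functions *)

Section Convex_functions.
Context {R : realType} {H : hilbertType R}.
Implicit Types (q : H -> \bar R) (x y z u v w : H).

Lemma dom_fineK q x : (forall w, -oo < q w)%E -> dom q x -> (fine (q x))%:E = q x.
Proof. by move=> qNy qx; rewrite fineK// fin_real// qNy. Qed.

Lemma Gamma0_fine_convex q x y (t : R) : Gamma0 q -> dom q x -> dom q y ->
  0 < t < 1 -> dom q (t *: x + (1 - t) *: y) /\
  fine (q (t *: x + (1 - t) *: y)) <= t * fine (q x) + (1 - t) * fine (q y).
Proof.
move=> Gq qx qy t01; have qNy := Gamma0_gtNy Gq.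
have h := Gamma0_convex Gq (x := x) (y := y) t01 (fun _ _ => I).
rewrite -(dom_fineK qNy qx) -(dom_fineK qNy qy) -!EFinM -EFinD in h.
have d : dom q (t *: x + (1 - t) *: y).
  by rewrite /dom/= (le_lt_trans h)// ltry.
by split => //; rewrite -lee_fin dom_fineK.
Qed.

Lemma subdiff_dom q x u : Gamma0 q -> subdiff q x u -> dom q x.
Proof.
move=> Gq; have [w qw] := Gamma0_dom Gq.
move=> /(_ w); rewrite /dom/=; case: (q x) => [r _|//|]; rewrite ?ltry//.
  by rewrite addye// leye_eq => /eqP qwy; move: qw; rewrite /dom/= qwy.
Qed.

Lemma subdiff_fine q x u w : Gamma0 q -> subdiff q x u -> dom q w ->
  fine (q x) + inner u (w - x) <= fine (q w).
Proof.
move=> Gq ux qw; have qNy := Gamma0_gtNy Gq; have qx := subdiff_dom Gq ux.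
have h := ux w.
by rewrite -(dom_fineK qNy qx) -(dom_fineK qNy qw) -EFinD lee_fin in h.
Qed.

(** The subdifferential is closed and convex as an intersection of half-spaces, so 0 has a
    projection on it, and Cauchy-Schwarz shows this projection to have minimal norm. The default
    value 0 of [xget] is therefore not taken. *)
Lemma min_subgradP q x : Gamma0 q -> dom_subdiff q x ->
  subdiff q x (min_subgrad q x).
Proof.
move=> Gq dx; have [u0 u0x] := dx; have qNy := Gamma0_gtNy Gq.
have qx := subdiff_dom Gq u0x.
have [|||p px hp] := @nearest_point R H (subdiff q x) 0.
- rewrite (_ : subdiff q x = \bigcap_y [set u | (q x + (inner u (y - x))%:E <= q y)%E]); last first.
    by apply/seteqP; split => [u hu y _|u hu y]; [exact: hu|exact: (hu y I)].
  apply: closed_bigI => y _.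
  have [qyf|qyy] := pselect (dom q y); last first.
    rewrite (_ : [set u | _] = setT); first exact: closedT.
    apply/seteqP; split => // u _ /=.
    by move/negP: qyy; rewrite -leNgt leye_eq => /eqP ->; rewrite leey.
  rewrite (_ : [set u | _] = (fun u => inner u (y - x) : R^o) @^-1`
      [set r | r <= fine (q y) - fine (q x)]); last first.
    apply/seteqP; split => u /=; rewrite -(dom_fineK qNy qx) -(dom_fineK qNy qyf);
      by rewrite -EFinD lee_fin/= lerBrDl.
  apply: closed_comp; last exact: closed_le.
  by move=> u _; exact: inner_continuous.
- by exists u0.
- move=> u v t ux vx t01 y.
  have uxy := ux y; have vxy := vx y; have [a qa] : exists a, q x = a%:E.
    by exists (fine (q x)); rewrite dom_fineK.
  move: uxy vxy; rewrite qa; case: (q y) (qNy y) => // [r _|_ _ _]; last first.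
    by rewrite leey.
  rewrite -!EFinD !lee_fin innerDl !innerZl; nra.
have ex : [set u | subdiff q x u /\
    forall v, subdiff q x v -> (`|u| <= `|v|)%R] p.
  split => // v vx; have := hp v vx.
  rewrite sub0r innerNl innerBr inner_norm => h.
  have := cauchy_schwarz p v; have [->|p0] := eqVneq p 0; first by rewrite normr0.
  have : 0 < `|p| by rewrite normr_gt0.
  by move=> pp hcs; rewrite -(ler_pM2l pp); nra.
by have [] := xgetPex 0 (ex_intro _ p ex).
Qed.

Lemma riesz_diff (phi : H -> R) x : differentiable (phi : H -> R^o) x ->
  exists u, forall v, 'd (phi : H -> R^o) x v = inner u v.
Proof.
move=> dphi.
have /linear_boundedP[M [_ hM]] :
    bounded_near ('d (phi : H -> R^o) x) (nbhs (0 : H)).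
  by apply/linear_bounded_continuous; exact: diff_continuous.
apply: (@riesz _ _ _ (M + 1)).
- by move=> y z; rewrite linearD.
- by move=> a y; rewrite linearZ.
- by move=> y; apply: (hM (M + 1)); rewrite ltrDl.
Qed.

Lemma gradE q x v : differentiable (fun y : H => fine (q y) : R^o) x ->
  'd (fun y : H => fine (q y) : R^o) x v = inner (grad q x) v.
Proof.
by move=> /riesz_diff/(xgetPex 0) /(_ v); exact.
Qed.

(** The difference quotients of [phi] at [x] towards [y] are at most [phi y - phi x]. Convexity is
    asked only along this segment, so the lemma also covers functions that are convex merely on a
    subset. *)
Lemma convex_above_tangent (phi : H -> R) x y :
  differentiable (phi : H -> R^o) x ->
  (forall t : R, 0 < t < 1 -> phi (t *: y + (1 - t) *: x) <= t * phi y + (1 - t) * phi x) ->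
  phi x + 'd (phi : H -> R^o) x (y - x) <= phi y.
Proof.
move=> dphi cphi; rewrite addrC -lerBrDr -deriveE//.
set v := y - x.
have /cvg_dnbhs_at_right := (@diff_derivable _ _ _ (phi : H -> R^o) x v dphi).
move=> dv.
apply: (cvgr_to_le dv).
near=> t.
have t0 : 0 < t by near: t; exact: nbhs_right_gt.
have t1 : t < 1 by near: t; exact: nbhs_right_lt.
rewrite /= /GRing.scale/= mulrC ler_pdivrMr//.
have := cphi t; rewrite t0 t1 => /(_ isT).
have -> : t *: y + (1 - t) *: x = t *: v + x.
  by rewrite scalerBr scalerBl scale1r addrA addrAC.
by rewrite mulrBl mul1r; lra.
Unshelve. all: by end_near. Qed.

Lemma dom_tangent q x y : Gamma0 q -> dom q x -> dom q y ->
  differentiable (fun w : H => fine (q w) : R^o) x ->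
  fine (q x) + inner (grad q x) (y - x) <= fine (q y).
Proof.
move=> Gq qx qy dq; rewrite -gradE//; apply: convex_above_tangent => // t t01.
exact: (Gamma0_fine_convex Gq qy qx t01).2.
Qed.

End Convex_functions.

(** * Descent inequality from relative smoothness *)

Section Relative_smoothness.
Context {R : realType} {H : hilbertType R}.
Variables (F q : H -> \bar R) (zeta : R -> R) (C : set H).
Hypotheses (Gq : Gamma0 q) (smooth : pair_smooth F zeta q C).
Hypothesis convC : forall x y t, C x -> C y -> 0 < t < 1 ->
  C (t *: x + (1 - t) *: y).

Lemma smooth_tangent x y : C x -> C y ->
  fine (q x) + inner (grad q x) (y - x) <= fine (q y).
Proof.
case: smooth => FNy z0 Cq [C0 [_ CC0 _ [_ dq] _]] _ Cx Cy.
by apply: dom_tangent; [by []|exact: Cq|exact: Cq|exact: (dq _ (CC0 _ Cx)).2].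
Qed.

(** Convexity of [F - q] bounds the Bregman divergence of [q] by that of [F], which the smoothness
    constant bounds by a multiple of [zeta t]. *)
Lemma smooth_descent : exists2 K : R, 0 <= K & forall x s (t : R),
  C x -> C s -> 0 < t <= 1 ->
  fine (q (x + t *: (s - x))) <=
    fine (q x) + t * inner (grad q x) (s - x) + K * zeta t.
Proof.
case: smooth => FNy z0 Cq [C0 [oC0 CC0 C0F [dF dq] cFq]] Kfin.
(* The maximum covers a constant that is negative or -oo. *)
exists (Num.max 0 (fine (smooth_constant F zeta C))); first by rewrite le_max lexx.
set K := Num.max _ _.
move=> x s t Cx Cs t01.
have t0 : 0 < t by case/andP: t01.
set y := x + t *: (s - x).
have yE : y = t *: s + (1 - t) *: x.
  by rewrite /y scalerBr scalerBl scale1r addrCA addrC addrAC -addrA.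
have Cy : C y.
  case/andP: t01 => _; rewrite le_eqVlt => /predU1P[t1|t1].
    by rewrite yE t1 scale1r subrr scale0r addr0.
  by rewrite yE; apply: convC => //; rewrite t0.
have finF w : C w -> F w = (fine (F w))%:E.
  by move=> Cw; rewrite fineK//; have [] := dF _ (CC0 _ Cw).
have finq w : C w -> q w = (fine (q w))%:E.
  by move=> Cw; rewrite fineK//; have [] := dq _ (CC0 _ Cw).
(* [gF] and [gq] keep unification from unfolding the two gradients. *)
have [gF gFE] : exists u, grad F x = u by exists (grad F x).
have D1 : fine (F y) - fine (F x) - inner gF (y - x) <= K * zeta t.
  have : (bregman F y x / (zeta t)%:E <= K%:E)%E.
    apply: (@le_trans _ _ (smooth_constant F zeta C)).
      by apply: ereal_sup_ubound; exists x, s, t.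
    move: Kfin; rewrite /K; case: (smooth_constant F zeta C) => //= [r _|_].
      by rewrite lee_fin le_max lexx orbT.
    exact: leNye.
  rewrite /bregman gFE (finF _ Cy) (finF _ Cx) -!EFinB /=.
  set D := fine _ - _ - _.
  (* When [zeta t] vanishes, a positive divergence would make the quotient +oo, so the divergence is
     nonpositive. *)
  have := z0 t t01; rewrite le_eqVlt => /predU1P[<-|zt].
    rewrite mulr0; have [//|D0] := leP D 0.
    by rewrite inve0 mulry gtr0_sg// mul1e leye_eq.
  by rewrite inver gt_eqF// -EFinM lee_fin ler_pdivrMr.
have dfq w : C w -> differentiable (fun v : H => fine (F v) - fine (q v) : R^o) w.
  move=> Cw; apply: differentiableB; first exact: (dF _ (CC0 _ Cw)).2.
  exact: (dq _ (CC0 _ Cw)).2.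
have D2 : fine (F x) - fine (q x) + 'd (fun v : H => fine (F v) - fine (q v) : R^o) x (y - x)
    <= fine (F y) - fine (q y).
  apply: (@convex_above_tangent _ _ (fun v => fine (F v) - fine (q v))); first exact: dfq.
  move=> r r01.
  have seg (a : R) : 0 <= a <= 1 -> C (a *: y + (1 - a) *: x).
    move=> /andP[a0 a1]; move: a0; rewrite le_eqVlt => /predU1P[<-|a0].
      by rewrite scale0r add0r subr0 scale1r.
    move: a1; rewrite le_eqVlt => /predU1P[->|a1].
      by rewrite subrr scale0r scale1r addr0.
    by apply: convC => //; rewrite a0.
  have Cr := seg r; have := cFq y x r r01 (fun a ha => CC0 _ (seg a ha)).
  have {}Cr : C (r *: y + (1 - r) *: x) by apply: Cr; case/andP: r01; lra.
  rewrite (finF _ Cr) (finF _ Cx) (finF _ Cy) (finq _ Cr) (finq _ Cx) (finq _ Cy).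
  by rewrite -!EFinB -!EFinM -EFinD lee_fin.
have dF_gF v : 'd (fun w : H => fine (F w) : R^o) x v = inner gF v.
  by rewrite gradE ?gFE//; exact: (dF _ (CC0 _ Cx)).2.
clear gFE; have [gq gqE] : exists u, grad q x = u by exists (grad q x).
have dq_gq v : 'd (fun w : H => fine (q w) : R^o) x v = inner gq v.
  by rewrite gradE ?gqE//; exact: (dq _ (CC0 _ Cx)).2.
rewrite gqE; clear gqE.
have e1 u : inner u (y - x) = t * inner u (s - x).
  by rewrite /y [x + _]addrC addrK innerZr.
have : 'd (fun v : H => fine (F v) - fine (q v) : R^o) x (y - x) =
    inner gF (y - x) - inner gq (y - x).
  rewrite -dF_gF -dq_gq.
  have -> : (fun v : H => fine (F v) - fine (q v) : R^o) =
    (fun v : H => fine (F v) : R^o) - (fun v : H => fine (q v) : R^o) by [].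
  by rewrite diffB; [|exact: (dF _ (CC0 _ Cx)).2|exact: (dq _ (CC0 _ Cx)).2].
move: D1 D2 (e1 gF) (e1 gq); move: ('d _ x (y - x)) => d.
by move: (fine (F x)) (fine (F y)) (fine (q x)) (fine (q y)) (K * zeta t) => *; lra.
Qed.

End Relative_smoothness.

Lemma adjointP (R : realType) (U V : hilbertType R) (A : {linear U -> V}) x y :
  bounded_operator A -> inner (A x) y = inner x (adjoint A y).
Proof.
move=> [M AM].
have [|||u hu] := @riesz R U (fun x => inner (A x) y) (`|M| * `|y|).
- by move=> a b; rewrite linearD innerDl.
- by move=> a b; rewrite linearZ innerZl.
- move=> a; apply: (le_trans (normr_inner _ _)).
  rewrite mulrAC ler_wpM2r//; apply: le_trans (AM a) _.
  by rewrite ler_wpM2r// ler_norm.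
have ex : [set u | forall x, inner (A x) y = inner x u] u.
  by move=> a; rewrite hu innerC.
exact: (xgetPex 0 (ex_intro _ u ex)).
Qed.

Lemma lte_EFinM (R : realFieldType) (a k : R) (e : \bar R) : 0 < k ->
  (a%:E < k%:E * e)%E = ((a / k)%:E < e)%E.
Proof.
move=> k0; case: e => [r||].
- by rewrite -EFinM !lte_fin ltr_pdivrMr// mulrC.
- by rewrite gt0_muley ?lte_fin// !ltry.
- by rewrite gt0_muleNy ?lte_fin// !ltNge !leNye.
Qed.

(** * Variation of the Moreau envelope with its point and its parameter *)

Section Moreau_envelope.
Context {R : realType} {H : hilbertType R}.
Variable g : H -> \bar R.
Hypothesis Gg : Gamma0 g.
Implicit Types u v w y : H.

(** The subgradient [u0] supplies an affine minorant of [g], which bounds the proximal objective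
    below and makes its minimizer exist. The conclusion is the optimality condition of that
    minimizer. *)
Lemma prox_subdiff (be : R) v v0 u0 : 0 < be -> subdiff g v0 u0 ->
  let y := prox (fun w => be%:E * g w)%E v in subdiff g y (be^-1 *: (v - y)).
Proof.
move=> be0 hu0 y; have gNy := Gamma0_gtNy Gg.
have bgNy w : (-oo < be%:E * g w)%E.
  by case: (g w) (gNy w) => // [r _|_]; rewrite ?ltNyr// gt0_muley ?lte_fin.
have bgE w : dom g w -> (be%:E * g w)%E = (be * fine (g w))%:E.
  by move=> dw; rewrite -{1}(dom_fineK gNy dw) EFinM.
have dv0 := subdiff_dom Gg hu0.
have ex : argmin (fun w => be%:E * g w + (2^-1 * `|v - w| ^+ 2)%:E)%E !=set0.
  (* The lower bound is the minimum, reached at [v - be *: u0], of the proximal objective with [g]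
     replaced by its affine minorant. *)
  apply: (@proximal_argmin_nonempty _ _ _ _
     (be * fine (g v0) - 2^-1 * be ^+ 2 * `|u0| ^+ 2 + be * inner u0 (v - v0))).
  - exact: bgNy.
  - by exists v0; rewrite /dom/= bgE// ltry.
  - move=> a b t t01 _; have := Gamma0_convex Gg (x := a) (y := b) t01 (fun _ _ => I).
    have be0' : (0 <= be%:E)%E by rewrite lee_fin ltW.
    move=> /(lee_wpmul2l be0')/le_trans; apply.
    have /andP[t0 t1] := t01.
    have tp : (0 < t%:E)%E by rewrite lte_fin.
    have tp' : (0 < (1 - t)%:E)%E by rewrite lte_fin subr_gt0.
    have bep : (0 < be%:E)%E by rewrite lte_fin.
    rewrite /=; case: (g a) (gNy a) => // [ra _|_]; case: (g b) (gNy b) => // [rb _|_].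
    + rewrite -![in leRHS]EFinM -![in leLHS]EFinM -!EFinD -?EFinM lee_fin; lra.
    + by rewrite !(gt0_muley bep, gt0_muley tp') -EFinM addey// gt0_muley// leey.
    + by rewrite !(gt0_muley bep, gt0_muley tp) -EFinM addye// gt0_muley// leey.
    + by rewrite !(gt0_muley bep, gt0_muley tp, gt0_muley tp') addye// gt0_muley// leey.
  - move=> a r; rewrite lte_EFinM// => /(Gamma0_lsc Gg)[V aV hV].
    by exists V => // b /hV; rewrite lte_EFinM.
  - move=> w; have [dw|dw] := pselect (dom g w); last first.
      have -> : g w = +oo%E.
        by apply/eqP; move/negP : dw; rewrite -leNgt leye_eq.
      by rewrite gt0_muley ?lte_fin// addye// leey.
    rewrite bgE// -EFinD lee_fin.
    have := ler_wpM2l (ltW be0) (subdiff_fine Gg hu0 dw).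
    have := sqr_ge0 `|w - v + be *: u0|.
    inner_expand; rewrite (innerC w v) (innerC u0 w) (innerC u0 v); lra.
have yP : argmin (fun w => be%:E * g w + (2^-1 * `|v - w| ^+ 2)%:E)%E y.
  exact: (xgetPex 0 ex).
clearbody y.
have dy : dom g y.
  apply/not_notP => dy; have := yP v0; rewrite /= (bgE v0)//.
  have -> : g y = +oo%E.
    by apply/eqP; move/negP : dy; rewrite -leNgt leye_eq.
  by rewrite gt0_muley ?lte_fin// addye// -EFinD leye_eq.
move=> w; have [dw|dw] := pselect (dom g w); last first.
  have -> : g w = +oo%E.
    by apply/eqP; move/negP : dw; rewrite -leNgt leye_eq.
  by rewrite leey.
rewrite -(dom_fineK gNy dy) -(dom_fineK gNy dw) -EFinD lee_fin.
rewrite innerZl -subr_ge0 -(pmulr_rge0 _ be0).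
rewrite (_ : be * _ = be * (fine (g w) - fine (g y)) - inner (v - y) (w - y)); last first.
  by field; rewrite gt_eqF.
apply: (@small_quadratic_ge0 _ _ (2^-1 * `|w - y| ^+ 2)) => t t01.
have [dt ct] := Gamma0_fine_convex Gg dw dy t01.
have := yP (t *: w + (1 - t) *: y); rewrite /= (bgE y)// (bgE (t *: w + _))// -!EFinD lee_fin.
have /andP[t0 _] := t01.
have bct := ler_wpM2l (ltW be0) ct.
move: bct; set gt := fine (g (t *: w + _)) => bct; clearbody gt.
inner_expand; rewrite (innerC w v) (innerC y v) (innerC w y); nra.
Qed.

(* The value [fine (g y) + (2 * be)^-1 * `|v - y| ^+ 2] at the proximal point
   [y] of [v] is the Moreau envelope of [g] of parameter [be]. *)
Lemma moreau_minorant (be : R) v y w : 0 < be ->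
  subdiff g y (be^-1 *: (v - y)) -> dom g w ->
  fine (g y) + (2 * be)^-1 * `|v - y| ^+ 2 + inner (be^-1 *: (v - y)) (w - v)
    <= fine (g w).
Proof.
move=> be0 sy dw; have := subdiff_fine Gg sy dw.
have b0 : 0 < be^-1 by rewrite invr_gt0.
rewrite invfM; have := mulr_ge0 (ltW b0) (sqr_ge0 `|v - y|).
inner_expand; rewrite ?(innerC w v) ?(innerC y v) ?(innerC w y); nra.
Qed.

(** The subgradient inequality at [v] loses [inner u (v - y)], which Young's inequality splits into
    [be / 2] times the squared norm of [u] and the quadratic term of the envelope. *)
Lemma moreau_lower (be : R) v y u : 0 < be ->
  subdiff g v u -> dom g y ->
  fine (g v) - be / 2 * `|u| ^+ 2 <= fine (g y) + (2 * be)^-1 * `|v - y| ^+ 2.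
Proof.
move=> be0 su dy; have := subdiff_fine Gg su dy.
have b0 : 0 < be^-1 by rewrite invr_gt0.
have := mulr_ge0 (ltW be0) (sqr_ge0 `|u - be^-1 *: (v - y)|).
have bb : be * be^-1 = 1 by rewrite mulfV ?gt_eqF.
rewrite (sqr_normB u) sqr_normZ innerZr invfM.
have -> : inner u (y - v) = - inner u (v - y) by rewrite -innerNr opprB.
move: (inner u (v - y)) (`|u| ^+ 2 : R) (`|v - y| ^+ 2 : R) => a b c.
have -> : be * (b - 2 * (be^-1 * a) + be^-1 ^+ 2 * c) =
    be * b - 2 * (be * be^-1) * a + (be * be^-1) * (be^-1 * c) by ring.
by rewrite bb; lra.
Qed.

(** The envelope of parameter [be'] at [v'] is tested at [w = t *: y + (1 - t) *: v'] with
    [t = be' / be], for which the quadratic term is exactly [t] times the one of parameter [be].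
    What remains is [1 - t] times the gap between [g v'] and the value [B] at [y], which
    [moreau_lower] controls. Expanding [B] around [v] gives the linear and quadratic terms. *)
Lemma moreau_step (be be' : R) v v' y y' u : 0 < be' <= be ->
  subdiff g y (be^-1 *: (v - y)) -> subdiff g y' (be'^-1 *: (v' - y')) ->
  subdiff g v' u ->
  fine (g y') + (2 * be')^-1 * `|v' - y'| ^+ 2 <=
  fine (g y) + (2 * be)^-1 * `|v - y| ^+ 2 + inner (be^-1 *: (v - y)) (v' - v)
   + (2 * be)^-1 * `|v' - v| ^+ 2 + (be - be') / 2 * `|u| ^+ 2.
Proof.
move=> /andP[be'0 be'be] sy sy' su.
have be0 : 0 < be by exact: lt_le_trans be'be.
have dy := subdiff_dom Gg sy; have dv' := subdiff_dom Gg su.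
pose t := be' / be; have t0 : 0 < t by rewrite divr_gt0.
have t1 : t <= 1 by rewrite ler_pdivrMr// mul1r.
set w := t *: y + (1 - t) *: v'.
have [dw cw] : dom g w /\ fine (g w) <= t * fine (g y) + (1 - t) * fine (g v').
  move: t1; rewrite le_eqVlt => /predU1P[t1|t1].
    by rewrite /w t1 subrr scale0r scale1r addr0; split => //; lra.
  by apply: Gamma0_fine_convex; rewrite ?t0.
have sw := subdiff_fine Gg sy' dw.
have e'w : fine (g y') + (2 * be')^-1 * `|v' - y'| ^+ 2 <=
           fine (g w) + (2 * be')^-1 * `|v' - w| ^+ 2.
  clearbody w; move: sw; have b0 : 0 < be'^-1 by rewrite invr_gt0.
  rewrite invfM; have := mulr_ge0 (ltW b0) (sqr_ge0 `|y' - w|).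
  inner_expand; rewrite ?(innerC w v') ?(innerC y' v') ?(innerC w y'); nra.
have vw : (2 * be')^-1 * `|v' - w| ^+ 2 = t * ((2 * be)^-1 * `|v' - y| ^+ 2).
  have -> : v' - w = t *: (v' - y).
    by rewrite /w scalerBl scale1r scalerBr opprD opprB addrCA (addrC v') subrK addrC.
  rewrite sqr_normZ /t; field; rewrite !gt_eqF//.
pose B := fine (g y) + (2 * be)^-1 * `|v' - y| ^+ 2.
have vB : fine (g v') - B <= be / 2 * `|u| ^+ 2.
  by have := moreau_lower be0 su dy; rewrite /B; lra.
have BE : B = fine (g y) + (2 * be)^-1 * `|v - y| ^+ 2 +
   inner (be^-1 *: (v - y)) (v' - v) + (2 * be)^-1 * `|v' - v| ^+ 2.
  rewrite /B invfM; inner_expand; rewrite ?(innerC v' v) ?(innerC y v) ?(innerC y v'); lra.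
rewrite -BE.
have tb : (1 - t) * (be / 2 * `|u| ^+ 2) = (be - be') / 2 * `|u| ^+ 2.
  by rewrite /t; field; rewrite gt_eqF.
have := ler_wpM2l (_ : 0 <= 1 - t) vB; rewrite subr_ge0 tb => /(_ t1).
move: e'w; rewrite vw; rewrite /B; nra.
Qed.

End Moreau_envelope.

(** * The potential along the iterations *)

Section One_step.
Context {R : realType} {Hp Hd Hv : hilbertType R}.
Variables (A : {linear Hp -> Hd}) (T : {linear Hp -> Hv}) (b : Hd).
Variable g : Hv -> \bar R.
Hypothesis Gg : Gamma0 g.

(* [x'], [y'] and [mu'] are the iterates following [x], [y] and [mu]; the point
   [w] is arbitrary, and [G] stands for the gradient of [f] at [x]. *)
Lemma one_step (x x' s w G : Hp) (y y' u : Hv) (mu mu' : Hd)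
    (fx fx' fw hx hx' hs hw Kz be be' rho rho' ga th M NA NT d Rb p V V' : R) :
  x' = x + ga *: (s - x) -> mu' = mu + th *: (A x' - b) ->
  0 <= ga -> 0 < be' <= be -> 0 <= rho <= rho' ->
  subdiff g y (be^-1 *: (T x - y)) -> subdiff g y' (be'^-1 *: (T x' - y')) ->
  subdiff g (T x') u -> `|u| <= M -> dom g (T w) ->
  fx + inner G (w - x) <= fw -> fx' <= fx + ga * inner G (s - x) + Kz ->
  hx' <= (1 - ga) * hx + ga * hs ->
  hs + inner G (s - w) + inner (be^-1 *: (T x - y)) (T (s - w)) +
    inner (mu + rho *: (A x - b)) (A (s - w)) <= hw ->
  `|A (s - x)| <= NA * d -> `|T (s - x)| <= NT * d -> `|A x' - b| <= Rb ->
  V = fx + (fine (g y) + (2 * be)^-1 * `|T x - y| ^+ 2) + hx +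
    inner mu (A x - b) + rho / 2 * `|A x - b| ^+ 2 - p ->
  V' = fx' + (fine (g y') + (2 * be')^-1 * `|T x' - y'| ^+ 2) + hx' +
    inner mu' (A x' - b) + rho' / 2 * `|A x' - b| ^+ 2 - p ->
  V' <= (1 - ga) * V + ga * (fw + fine (g (T w)) + hw - p + inner mu (A w - b) +
      rho / 2 * (2 * inner (A w - b) (A x - b) - `|A x - b| ^+ 2))
    + th * `|A x' - b| ^+ 2
    + (Kz + (NT * d) ^+ 2 / 2 * (ga ^+ 2 / be) + M ^+ 2 / 2 * (be - be') +
       (NA * d) ^+ 2 / 2 * (rho * ga ^+ 2) + Rb ^+ 2 / 2 * (rho' - rho)).
Proof.
move=> x'E mu'E ga0 bebe' /andP[rho0 rhorho'] sy sy' su uM dw tf df dh os eA eT eR.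
have be0 : 0 < be by case/andP: bebe' => b0; exact: lt_le_trans.
have Tx' : T x' - T x = ga *: T (s - x).
  by rewrite x'E linearD addrC addKr linearZ.
have Ax' : A x' - b = (A x - b) + ga *: A (s - x).
  by rewrite x'E linearD linearZ addrAC.
have ms := moreau_step Gg bebe' sy sy' su.
have mm := moreau_minorant Gg be0 sy dw.
have uM2 : `|u| ^+ 2 <= M ^+ 2 by rewrite lerXn2r ?nnegrE// (le_trans _ uM).
have T2 : `|T (s - x)| ^+ 2 <= (NT * d) ^+ 2.
  by rewrite lerXn2r ?nnegrE// (le_trans _ eT).
have A2 : `|A (s - x)| ^+ 2 <= (NA * d) ^+ 2.
  by rewrite lerXn2r ?nnegrE// (le_trans _ eA).
have R2 : `|A x' - b| ^+ 2 <= Rb ^+ 2.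
  by rewrite lerXn2r ?nnegrE// (le_trans _ eR).
move: ms; rewrite Tx' sqr_normZ innerZr => ms.
have mu'r : inner mu' (A x' - b) = inner mu (A x' - b) + th * `|A x' - b| ^+ 2.
  by rewrite mu'E innerDl innerZl inner_norm.
have Awx : A (w - x) = (A w - b) - (A x - b) by rewrite (linearB A) opprB addrA subrK.
set W := A w - b in Awx *.
set r := A x - b in Ax' os Awx *; set r' := A x' - b in Ax' R2 mu'r *.
have Asw : A (s - w) = A (s - x) - A (w - x).
  by rewrite !(linearB A, linearB T) opprB addrA subrK.
set e := A (s - x) in Ax' Asw A2.
clearbody W r r' e.
have r'2 : `|r'| ^+ 2 = `|r| ^+ 2 + 2 * (ga * inner r e) + ga ^+ 2 * `|e| ^+ 2.
  by rewrite Ax' sqr_normD innerZr sqr_normZ.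
have mur' : inner mu r' = inner mu r + ga * inner mu e.
  by rewrite Ax' innerDr innerZr.
(* The optimality of [s] against [w], recentred at [x]; the identity [A (w - x) = W - r] makes the
   residuals appear. *)
have os' : hs + inner G (s - x) + inner (be^-1 *: (T x - y)) (T (s - x)) +
    inner (mu + rho *: r) e <= hw + inner G (w - x) +
    inner (be^-1 *: (T x - y)) (T w - T x) + (inner mu W - inner mu r +
    rho * (inner W r - `|r| ^+ 2)).
  have -> : inner mu W - inner mu r + rho * (inner W r - `|r| ^+ 2) =
      inner (mu + rho *: r) (A (w - x)).
    rewrite Awx innerBr !innerDl !innerZl inner_norm (innerC W); ring.
  move: os; rewrite Asw; have -> : T (s - w) = T (s - x) - (T w - T x).
    by rewrite !(linearB A, linearB T) opprB addrA subrK.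
  move: (be^-1 *: _) (mu + _) (T w - T x) (T (s - x)) => q m tw ts.
  by rewrite !innerBr; lra.
move: mm os' ms; move: (inner (be^-1 *: (T x - y)) _) (inner (be^-1 *: (T x - y)) _) => q1 q2.
move: (fine (g y) + _) (fine (g y') + _) => E E' mm os' ms VE V'E.
(* The left-hand side is the first-order variation of the potential towards [s], with [h] replaced
   by its chord. The tangent inequality of [f] and the minorant of the envelope compare it with the
   values at [w]. *)
have key : inner G (s - x) + q2 + (hs - hx) + inner (mu + rho *: r) e <=
    fw + fine (g (T w)) + hw - p + inner mu W + rho / 2 * (2 * inner W r - `|r| ^+ 2) - V.
  by rewrite VE; lra.
have := ler_wpM2l ga0 key; rewrite innerDl innerZl.
have pT : (2 * be)^-1 * (ga ^+ 2 * `|T (s - x)| ^+ 2) <= (NT * d) ^+ 2 / 2 * (ga ^+ 2 / be).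
  have -> : (NT * d) ^+ 2 / 2 * (ga ^+ 2 / be) = (2 * be)^-1 * (ga ^+ 2 * (NT * d) ^+ 2).
    by field; rewrite gt_eqF.
  by rewrite ler_wpM2l ?invr_ge0 ?mulr_ge0 ?(ltW be0)// ler_wpM2l// sqr_ge0.
have pA : rho / 2 * (ga ^+ 2 * `|e| ^+ 2) <= (NA * d) ^+ 2 / 2 * (rho * ga ^+ 2).
  have -> : (NA * d) ^+ 2 / 2 * (rho * ga ^+ 2) = rho / 2 * (ga ^+ 2 * (NA * d) ^+ 2) by ring.
  by rewrite ler_wpM2l ?divr_ge0// ler_wpM2l// sqr_ge0.
have pM : (be - be') / 2 * `|u| ^+ 2 <= M ^+ 2 / 2 * (be - be').
  rewrite mulrC [leRHS]mulrAC -mulrA ler_wpM2r//.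
  by rewrite divr_ge0// subr_ge0; case/andP: bebe'.
have pR : (rho' - rho) / 2 * `|r'| ^+ 2 <= Rb ^+ 2 / 2 * (rho' - rho).
  rewrite mulrC [leRHS]mulrAC -mulrA ler_wpM2r//.
  by rewrite divr_ge0// subr_ge0.
rewrite V'E mu'r mur'.
have := congr1 (fun a => rho / 2 * a) r'2.
move: pR pT pM pA ms VE df dh; move: (`|r'| ^+ 2) (`|r| ^+ 2) (`|e| ^+ 2) (`|u| ^+ 2) (`|T (s - x)| ^+ 2).
move: (inner G _) (inner mu W) (inner mu r) (inner W r) (inner mu e) (inner r e).
move: ((NT * d) ^+ 2 / 2 * (ga ^+ 2 / be)) => a0 a1 a2 a3 a4 a5 a6 a7 a8 a9 a10 a11.
move: ((2 * be)^-1 * (ga ^+ 2 * a11)) (fine (g (T w))).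
move: (M ^+ 2) ((NA * d) ^+ 2) (Rb ^+ 2).
by clear; intros; lra.
Qed.
End One_step.

(** * Convergence of the Lyapunov sequence *)

Section Lyapunov.
Context {R : realType} {H : hilbertType R}.
Variables (mu r : nat -> H) (mus : H) (V ga be rho eps : nat -> R).
Variables (c B Rb L be_hi : R).
Hypotheses (ga01 : forall k, 0 < ga k <= 1) (c_gt0 : 0 < c).
Hypotheses (B_ge0 : 0 <= B) (L_ge0 : 0 <= L) (Rb_ge0 : 0 <= Rb).
Hypotheses (eps_ge0 : forall k, 0 <= eps k) (cvg_eps : cvgn (series eps)).
Hypotheses (cvg_ga2 : cvgn (series (fun k => ga k ^+ 2))).
Hypotheses (be_ge0 : forall k, 0 <= be k) (be_le : forall k, be k <= be_hi).
Hypotheses (cvg_be : be @ \oo --> 0).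
Hypotheses (cvg_gabe : cvgn (series (fun k => ga k * be k))).
Hypotheses (ncvg_ga : ~ cvgn (series ga)).
Variables (del : R).
Hypotheses (del_gt0 : 0 < del) (rho_ge : forall k, c^-1 + del <= rho k / 2).
Hypotheses (muS : forall k, mu k.+1 = mu k + (ga k / c) *: r k.+1).
Hypotheses (r_le : forall k, `|r k| <= Rb).
Hypotheses (r_step : forall k, `|r k.+1 - r k| <= L * ga k).
Hypotheses (V_step : forall k, V k.+1 <=
  (1 - ga k) * V k - ga k * (rho k / 2 * `|r k| ^+ 2)
   + ga k / c * `|r k.+1| ^+ 2 + eps k).
Hypotheses (V_ge : forall k,
  inner (mu k - mus) (r k) + rho k / 2 * `|r k| ^+ 2 - be k * B <= V k).

Let D k : R := `|mu k - mus| ^+ 2.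
Let a k : R := `|r k| ^+ 2.

Let ga_ge0 k : 0 <= ga k. Proof. by case/andP: (ga01 k) => /ltW. Qed.
Let ci_gt0 : 0 < c^-1. Proof. by rewrite invr_gt0. Qed.

Let a_ge0 k : 0 <= a k. Proof. exact: sqr_ge0. Qed.

Let a_step k : a k.+1 <= a k + 2 * Rb * L * ga k.
Proof.
have h1 := r_le k; have h2 := r_le k.+1; have h3 := r_step k.
have n1 := normr_ge0 (r k); have n2 := normr_ge0 (r k.+1).
have h4 : `|r k.+1| - `|r k| <= L * ga k.
  by apply: le_trans h3; exact: lerB_dist.
have Lg : 0 <= L * ga k by rewrite mulr_ge0.
rewrite /a -lerBlDl subr_sqr.
apply: (@le_trans _ _ (L * ga k * (`|r k.+1| + `|r k|))).
  by rewrite ler_wpM2r// addr_ge0.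
rewrite (_ : 2 * Rb * L * ga k = L * ga k * (Rb + Rb)); last by ring.
by rewrite ler_wpM2l// lerD.
Qed.

Let D_step k : c / 2 * D k.+1 = c / 2 * D k + ga k * inner (mu k - mus) (r k.+1)
   + ga k ^+ 2 / (2 * c) * a k.+1.
Proof.
rewrite /D /a muS (addrAC (mu k)) (sqr_normD (mu k - mus)) innerZr sqr_normZ.
by field; rewrite gt_eqF.
Qed.

(** The factor of [ga k ^+ 2] adds up the second-order term of [D_step], the replacement of [a k.+1]
    by [a k], and the replacement of [r k.+1] by [r k] in the pairing with [mu k - mus]. *)
Let E1 k : R := eps k + (ga k * be k) * B +
  ga k ^+ 2 * (Rb ^+ 2 / (2 * c) + 2 * Rb * L / c + L).

Let E1_ge0 k : 0 <= E1 k.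
Proof.
rewrite /E1 !addr_ge0//; first by rewrite !mulr_ge0.
by rewrite mulr_ge0 ?sqr_ge0// !addr_ge0// ?divr_ge0 ?mulr_ge0 ?sqr_ge0 ?(ltW c_gt0).
Qed.

Let cvg_E1 : cvgn (series E1).
Proof.
rewrite (_ : E1 = eps + B *: (fun k => ga k * be k) +
  (Rb ^+ 2 / (2 * c) + 2 * Rb * L / c + L) *: (fun k => ga k ^+ 2)).
  apply: is_cvg_seriesD; last exact: is_cvg_seriesZ.
  apply: is_cvg_seriesD => //; exact: is_cvg_seriesZ.
by apply/funext => k; rewrite /E1 !fctE /GRing.scale/= (mulrC B) (mulrC (_ + L)).
Qed.

(** The shift compensates the lower bound of [V]: by Young's inequality, the pairing with the
    residual costs at most [c / 4 * D k + Rb ^+ 2 / c]. *)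
Let cst : R := Rb ^+ 2 / c + be_hi * B.
Let u k : R := V k + c / 2 * D k + cst.

Let D_le k : c / 4 * D k <= u k.
Proof.
have := V_ge k; have h := rho_ge k.
have : - (`|mu k - mus| * Rb) <= inner (mu k - mus) (r k).
  have := normr_inner (mu k - mus) (r k); rewrite ler_norml => /andP[h1 _].
  by apply: le_trans h1; rewrite lerN2 ler_wpM2l.
have : 0 <= rho k / 2 * `|r k| ^+ 2.
  by rewrite mulr_ge0 ?sqr_ge0// (le_trans _ h)// addr_ge0 ?ltW.
have : be k * B <= be_hi * B by rewrite ler_wpM2r.
have : 0 <= c * (`|mu k - mus| / 2 - Rb / c) ^+ 2 by rewrite mulr_ge0 ?sqr_ge0 ?ltW.
rewrite (_ : c * _ ^+ 2 = c / 4 * D k - `|mu k - mus| * Rb + Rb ^+ 2 / c); last first.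
  by rewrite /D; field; rewrite gt_eqF.
by rewrite /u /cst; lra.
Qed.

(** Bounding [V k] below inside [- ga k * V k] cancels the increment of [c / 2 * D] up to the
    pairing of [mu k - mus] with [r k.+1 - r k]. That pairing is of order [ga k * (1 + D k)], and
    [D_le] turns [D k] into the multiplicative factor. The penalty absorbs [ga k / c * a k.+1] up to
    second order and leaves [del]. *)
Let u_step k :
  u k.+1 <= (1 + ga k ^+ 2 * (4 * L / c)) * u k - del * (ga k * a k) + E1 k.
Proof.
have := V_step k; have := D_step k; rewrite -!/(a _).
have hV := ler_wpM2l (ga_ge0 k) (V_ge k).
have haS := ler_wpM2l (mulr_ge0 (ga_ge0 k) (ltW ci_gt0)) (a_step k).
have hrho := ler_wpM2r (mulr_ge0 (ga_ge0 k) (a_ge0 k)) (rho_ge k).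
have cga : 0 <= c^-1 * (ga k * a k) by rewrite !mulr_ge0// ltW.
have dga : 0 <= del * (ga k * a k) by rewrite !mulr_ge0// ltW.
have hm : ga k * (inner (mu k - mus) (r k.+1) - inner (mu k - mus) (r k)) <=
    ga k ^+ 2 * L + ga k ^+ 2 * (4 * L / c) * u k.
  rewrite -innerBr expr2 -!mulrA -mulrDr ler_wpM2l//.
  apply: le_trans (cauchy_schwarz _ _) _.
  apply: (@le_trans _ _ ((1 + D k) * (L * ga k))).
    apply: ler_pM => //; rewrite /D; set m := `|_|.
    by have := sqr_ge0 (m - 2^-1); nra.
  have := D_le k; rewrite -(ler_pM2l ci_gt0) => hD.
  have : D k <= 4 * (c^-1 * u k).
    move: hD; rewrite (_ : c^-1 * (c / 4 * D k) = D k / 4); first by lra.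
    by field; rewrite gt_eqF.
  move=> /(ler_wpM2l (mulr_ge0 L_ge0 (ga_ge0 k))); lra.
have ha2 : ga k ^+ 2 / (2 * c) * a k.+1 <= ga k ^+ 2 * (Rb ^+ 2 / (2 * c)).
  rewrite [leRHS](_ : _ = ga k ^+ 2 / (2 * c) * Rb ^+ 2); last by ring.
  rewrite ler_wpM2l//; first by rewrite divr_ge0 ?sqr_ge0// mulr_ge0// ltW.
  by rewrite /a lerXn2r ?nnegrE// (le_trans (normr_ge0 _) (r_le k)).
move: hV haS hrho cga dga hm ha2; rewrite -/(a k) /u /E1.
move: (D k.+1) (D k) (V k.+1) (V k) (a k.+1) (a k) => D1 D0 V1 V0 a1 a0.
move: (inner _ (r k.+1)) (inner _ (r k)) => i1 i0.
move: cst (ga k) (be k) (rho k) (eps k) => C g b p e; intros; lra.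
Qed.

Let u_ge0 k : 0 <= u k.
Proof. by apply: le_trans (D_le k); rewrite mulr_ge0 ?sqr_ge0// divr_ge0// ltW. Qed.

Let cvg_u : cvgn u /\ cvgn (series (fun k => del * (ga k * a k))).
Proof.
apply: (@quasi_descent_mul _ u _ E1 (fun k => ga k ^+ 2 * (4 * L / c))) => //.
- by move=> k; rewrite !mulr_ge0// ltW.
- by move=> k; rewrite mulr_ge0 ?sqr_ge0// divr_ge0 ?mulr_ge0// ltW.
- rewrite (_ : (fun k => _) = (4 * L / c) *: (fun k => ga k ^+ 2)).
    exact: is_cvg_seriesZ.
  by apply/funext => k; rewrite !fctE /GRing.scale/= mulrC.
Qed.

(** The quasi-descent of [u] makes [ga k * a k] summable, and [a] grows by at most a multiple of
    [ga k] per step. *)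
Lemma residual_cvg0 : `|r k| @[k --> \oo] --> 0.
Proof.
have cga : cvgn (series (fun k => ga k * a k)).
  rewrite (_ : (fun k => _) = del^-1 *: (fun k => del * (ga k * a k))).
    by apply: is_cvg_seriesZ; exact: cvg_u.2.
  by apply/funext => k; rewrite !fctE /GRing.scale/= mulKf ?gt_eqF.
have a0 : a @ \oo --> 0.
  apply: (@cvgn0_of_slow_variation _ a ga (2 * Rb * L)) => //.
  by rewrite !mulr_ge0.
apply/cvgr0Pnorm_lt => d d_gt0.
have d2 : 0 < d ^+ 2 by rewrite exprn_gt0.
move/cvgr0Pnorm_lt : a0 => /(_ _ d2); apply: filterS => k.
by rewrite normr_id ger0_norm// ltr_sqr ?nnegrE// ltW.
Qed.

Lemma multiplier_bounded : exists Q, forall k, `|mu k - mus| <= Q.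
Proof.
have [Q hQ] := cvg_has_ub cvg_u.1.
exists (4 / c * Q + 1) => k.
have : `|u k| <= Q by apply: hQ; exists k.
rewrite ger0_norm// => uQ.
have : D k <= 4 / c * Q.
  rewrite -(@ler_pM2l _ (c / 4)) ?divr_gt0//.
  rewrite [leRHS](_ : _ = Q); first exact: le_trans uQ.
  by field; rewrite gt_eqF.
by rewrite /D; have := normr_ge0 (mu k - mus); nra.
Qed.

(** A squeeze: the positive part of [V] obeys a quasi-contraction with summable errors, while [V] is
    bounded below by a combination of the norm of [r k] and [be k], both vanishing. *)
Lemma potential_cvg0 : V @ \oo --> 0.
Proof.
pose e k := eps k + ga k ^+ 2 * (2 * Rb * L / c).
have e_ge0 k : 0 <= e k.
  by rewrite addr_ge0 ?mulr_ge0 ?sqr_ge0 ?invr_ge0// ltW.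
have ce : cvgn (series e).
  rewrite (_ : e = eps + (2 * Rb * L / c) *: (fun k => ga k ^+ 2)).
    by apply: is_cvg_seriesD => //; exact: is_cvg_seriesZ.
  by apply/funext => k; rewrite /e !fctE /GRing.scale/= mulrC.
have Vp0 : (fun k => Num.max (V k) 0) @ \oo --> 0.
  apply: (@cvgn0_of_quasi_contraction _ _ ga e) => //.
    by move=> k; rewrite le_max lexx orbT.
  move=> k; rewrite ge_max; apply/andP; split; last first.
    by rewrite addr_ge0// mulr_ge0 ?le_max ?lexx ?orbT// subr_ge0; case/andP: (ga01 k).
  have : (1 - ga k) * V k <= (1 - ga k) * Num.max (V k) 0.
    by rewrite ler_wpM2l ?le_max ?lexx// subr_ge0; case/andP: (ga01 k).
  have := V_step k; rewrite /e.
  have haS := ler_wpM2l (mulr_ge0 (ga_ge0 k) (ltW ci_gt0)) (a_step k).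
  have hrho := ler_wpM2r (mulr_ge0 (ga_ge0 k) (a_ge0 k)) (rho_ge k).
  have dga : 0 <= del * (ga k * a k) by rewrite !mulr_ge0// ltW.
  move: haS hrho dga; rewrite /a.
  move: (ga k) (rho k) (eps k) (V k) (V k.+1) (Num.max _ _) (`|r k.+1|) (`|r k|).
  intros; lra.
have [Q hQ] := multiplier_bounded.
have Q0 : 0 <= Q := le_trans (normr_ge0 _) (hQ 0%N).
have low : (fun k => - (Q * `|r k| + be k * B)) @ \oo --> 0.
  rewrite -oppr0; apply: cvgN; rewrite -[X in _ --> X]addr0; apply: cvgD.
    rewrite -[X in _ --> X](mulr0 Q); apply: cvgM; first exact: cvg_cst.
    exact: residual_cvg0.
  by rewrite -[X in _ --> X](mul0r B); apply: cvgM => //; exact: cvg_cst.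
apply: (squeeze_cvgr _ low Vp0); apply: nearW => k.
rewrite le_max lexx/= andbT; apply: le_trans (V_ge k).
have := normr_inner (mu k - mus) (r k); rewrite ler_norml => /andP[h1 _].
have h2 : `|mu k - mus| * `|r k| <= Q * `|r k| by rewrite ler_wpM2r.
have : 0 <= rho k / 2 * `|r k| ^+ 2.
  by rewrite mulr_ge0 ?sqr_ge0// (le_trans _ (rho_ge k))// addr_ge0 ?ltW.
lra.
Qed.

Lemma multiplier_distance_cvg : cvgn (fun k => `|mu k - mus| ^+ 2).
Proof.
rewrite (_ : (fun k => _) = 2 / c *: (u - V - (fun=> cst))).
  apply: is_cvgZl_tmp; apply: is_cvgB; last exact: is_cvg_cst.
  by apply: is_cvgB; [exact: cvg_u.1|exact: cvgP potential_cvg0].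
apply/funext => k; rewrite !fctE /GRing.scale/= /u /D; field; rewrite gt_eqF//.
Qed.

End Lyapunov.

(* [q + inner (mu k) W] stands for Phi(w) - p + <mu_k, A w - b>: it varies slowly
   and drives the decrease of the vanishing potential [V]. *)
Lemma dual_gap_liminf (R : realType) (H : hilbertType R) (mu r : nat -> H)
    (V ga rho eps : nat -> R) (c rho_hi q : R) (W : H) :
  (forall k, 0 < ga k <= 1) -> 0 < c ->
  (forall k, 0 <= eps k) -> cvgn (series eps) -> ~ cvgn (series ga) ->
  (forall k, 0 <= rho k <= rho_hi) ->
  (forall k, mu k.+1 = mu k + (ga k / c) *: r k.+1) ->
  `|r k| @[k --> \oo] --> 0 -> V @ \oo --> 0 ->
  (forall k, V k.+1 <= (1 - ga k) * V k + ga k * (q + inner (mu k) W +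
      rho k / 2 * (2 * inner W (r k) - `|r k| ^+ 2))
   + ga k / c * `|r k.+1| ^+ 2 + eps k) ->
  forall eta, 0 < eta -> \forall k \near \oo, - eta <= q + inner (mu k) W.
Proof.
move=> ga01 c0 e0 ce ncg rho01 muS r0 V0 dV.
have ga0 k : 0 <= ga k by case/andP: (ga01 k) => /ltW.
have ci0 : 0 <= c^-1 by rewrite invr_ge0 ltW.
have rS0 : `|r k.+1| @[k --> \oo] --> 0.
  by rewrite (cvg_shiftS (fun k => `|r k| : R^o)).
(* The multiplier update gives the slow variation, governed by the vanishing residual. The third
   sequence collects [- V k] and the residual terms of the decrease. *)
apply: (@window_lower_bound _ V (fun k => q + inner (mu k) W)
   (fun k => c^-1 * `|W| * `|r k.+1|)
   (fun k => - V k + rho_hi * `|W| * `|r k| + c^-1 * (`|r k.+1| * `|r k.+1|)) eps ga) => //.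
- by move=> k; case/andP: (ga01 k) => /ltW -> ->.
- exact: cvgP V0.
- rewrite -[X in _ --> X](mulr0 (c^-1 * `|W|)).
  by apply: cvgM => //; exact: cvg_cst.
- rewrite -[X in _ --> X]addr0; apply: cvgD.
    rewrite -[X in _ --> X]addr0; apply: cvgD; first by rewrite -oppr0; exact: cvgN.
    rewrite -[X in _ --> X](mulr0 (rho_hi * `|W|)).
    by apply: cvgM => //; exact: cvg_cst.
  rewrite -[X in _ --> X](mulr0 c^-1); apply: cvgM; first exact: cvg_cst.
  by rewrite -[X in _ --> X](mulr0 0); exact: cvgM.
- move=> k; rewrite muS innerDl innerZl.
  have := ler_wpM2l (mulr_ge0 (ga0 k) ci0) (cauchy_schwarz (r k.+1) W); lra.
- move=> k; have := dV k; have /andP[rk0 rkh] := rho01 k.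
  have h1 : rho k * inner W (r k) <= rho_hi * (`|W| * `|r k|).
    apply: (@le_trans _ _ (rho k * (`|W| * `|r k|))).
      by rewrite ler_wpM2l// cauchy_schwarz.
    by rewrite ler_wpM2r// mulr_ge0.
  have h2 := ler_wpM2l (ga0 k) h1.
  have h3 : 0 <= ga k * (rho k / 2 * `|r k| ^+ 2).
    by rewrite !mulr_ge0// ?invr_ge0// sqr_ge0.
  move: h2 h3; move: (inner _ _) (inner _ _) (`|W|) (`|r k|) (`|r k.+1|) (V k) (V k.+1).
  move: (ga k) (rho k) (eps k); clear; intros; lra.
Qed.

(** * The primal-dual problem *)

Lemma lower_semicontinuous_add (R : realType) (X : topologicalType)
    (p q : X -> \bar R) :
  (forall x, -oo < p x)%E -> (forall x, -oo < q x)%E ->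
  lower_semicontinuous p -> lower_semicontinuous q ->
  lower_semicontinuous (fun x => p x + q x)%E.
Proof.
move=> pNy qNy lp lq x a apq.
have [a1 [a2 [pa1 qa2 aa]]] :
    exists a1 a2, [/\ (a1%:E < p x)%E, (a2%:E < q x)%E & a <= a1 + a2].
  move: apq; case: (p x) (pNy x) => // [r _|_]; case: (q x) (qNy x) => // [s _|_].
  - rewrite -EFinD lte_fin => ars; exists (r - (r + s - a) / 2), (s - (r + s - a) / 2).
    by rewrite !lte_fin; split; lra.
  - by move=> _; exists (r - 1), (a - r + 1); rewrite lte_fin ltry; split=> //; lra.
  - by move=> _; exists (a - s + 1), (s - 1); rewrite lte_fin ltry; split=> //; lra.
  - by move=> _; exists a, 0; rewrite !ltry; split=> //; lra.
have [V1 xV1 hV1] := lp x _ pa1; have [V2 xV2 hV2] := lq x _ qa2.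
exists (V1 `&` V2); first exact: filterI.
move=> y [/hV1 py /hV2 qy]; apply: (@le_lt_trans _ _ (a1%:E + a2%:E)%E).
  by rewrite -EFinD lee_fin.
exact: lteD.
Qed.

Lemma ell1_nneg_series (R : realType) (u : nat -> R) :
  ell1_nneg u -> cvgn (series u).
Proof.
move=> [cu u0]; rewrite (_ : u = (fun k => `|u k|)) //.
by apply/funext => k; rewrite ger0_norm.
Qed.

Section Primal_dual_problem.
Context {R : realType} {Hp Hd Hv : hilbertType R}.
Variables (A : {linear Hp -> Hd}) (T : {linear Hp -> Hv}) (b : Hd).
Variables (f h : Hp -> \bar R) (g : Hv -> \bar R).
Hypotheses (Gg : Gamma0 g) (Gf : Gamma0 f) (GgT : Gamma0 (g \o T)) (Gh : Gamma0 h).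
Hypotheses (domf : dom h `<=` dom f) (domg : forall w, dom h w -> dom g (T w)).

(** Meant for points of [dom h], where the three values are finite. *)
Definition real_objective (w : Hp) : R := fine (f w) + fine (g (T w)) + fine (h w).

Lemma primal_objectiveE w : dom h w ->
  primal_objective f g h T w = (real_objective w)%:E.
Proof.
move=> hw; rewrite /primal_objective /real_objective !EFinD.
rewrite (dom_fineK (Gamma0_gtNy Gf) (domf hw)) (dom_fineK (Gamma0_gtNy Gh) hw).
by rewrite (dom_fineK (Gamma0_gtNy Gg) (domg hw)).
Qed.

Lemma primal_objective_ndom w : ~ dom h w -> primal_objective f g h T w = +oo%E.
Proof.
move=> /negP; rewrite -leNgt leye_eq /primal_objective => /eqP ->.
by rewrite addey// adde_eq_ninfty negb_or -!ltNye (Gamma0_gtNy Gf) (Gamma0_gtNy Gg).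
Qed.

Lemma lagrangianE w m : dom h w ->
  lagrangian f g h T A b w m = (real_objective w + inner m (A w - b))%:E.
Proof. by move=> /primal_objectiveE; rewrite /lagrangian /primal_objective => ->. Qed.

Lemma lagrangian_ndom w m : ~ dom h w -> lagrangian f g h T A b w m = +oo%E.
Proof. by move=> /primal_objective_ndom; rewrite /lagrangian /primal_objective => ->. Qed.

Lemma saddle_point_dual xs m : saddle_point f g h T A b xs m ->
  [/\ A xs = b, dom h xs & forall w, dom h w ->
    real_objective xs <= real_objective w + inner m (A w - b)].
Proof.
move=> sp; have [x0 hx0] := Gamma0_dom Gh.
have hxs : dom h xs.
  apply/not_notP => nh; have [_] := sp x0 m.
  by rewrite lagrangian_ndom// lagrangianE// leye_eq.
have Axs : A xs = b.
  (* Moving the multiplier along the residual raises the Lagrangian by the squared residual, which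
     must vanish. *)
  have [+ _] := sp xs (m + (A xs - b)).
  rewrite !lagrangianE// lee_fin innerDl inner_norm => le_m.
  apply/eqP; rewrite -subr_eq0 -normr_eq0 -sqrf_eq0 eq_le sqr_ge0 andbT.
  by move: le_m; lra.
split=> // w hw; have [_] := sp w m.
by rewrite !lagrangianE// lee_fin Axs subrr inner0r addr0.
Qed.

Lemma dual_saddle_point xs m : A xs = b -> dom h xs ->
  (forall w, dom h w -> real_objective xs <= real_objective w + inner m (A w - b)) ->
  saddle_point f g h T A b xs m.
Proof.
move=> Axs hxs dm w m'; rewrite !(lagrangianE _ hxs) Axs subrr !inner0r; split=> //.
have [hw|hw] := pselect (dom h w); last by rewrite lagrangian_ndom// leey.
by rewrite lagrangianE// lee_fin addr0; exact: dm.
Qed.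

Lemma closed_primal_sublevel (e : R) :
  closed [set w | (primal_objective f g h T w <= e%:E)%E].
Proof.
have lobj : lower_semicontinuous (primal_objective f g h T).
  apply: lower_semicontinuous_add; [|exact: Gamma0_gtNy Gh| |exact: Gamma0_lsc Gh].
    by move=> w; rewrite ltNye adde_eq_ninfty negb_or -!ltNye (Gamma0_gtNy Gf) (Gamma0_gtNy Gg).
  apply: lower_semicontinuous_add; first exact: Gamma0_gtNy Gf.
  - exact: Gamma0_gtNy GgT.
  - exact: Gamma0_lsc Gf.
  - exact: Gamma0_lsc GgT.
rewrite -[X in closed X]setCK; apply: open_closedC.
rewrite openE => w /= /negP; rewrite -ltNge => /lobj[V wV hV].
by apply: filterS wV => y /hV; rewrite ltNge => /negP.
Qed.

Lemma convex_primal_sublevel (e : R) (y z : Hp) (t : R) :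
  (primal_objective f g h T y <= e%:E)%E -> (primal_objective f g h T z <= e%:E)%E ->
  0 < t < 1 -> (primal_objective f g h T (t *: y + (1 - t) *: z)%R <= e%:E)%E.
Proof.
have dom_of w : (primal_objective f g h T w <= e%:E)%E -> dom h w.
  by move=> hw; apply/not_notP => /primal_objective_ndom ow; rewrite ow leye_eq in hw.
move=> hy hz t01; have dy := dom_of _ hy; have dz := dom_of _ hz.
have [df cf] := Gamma0_fine_convex Gf (domf dy) (domf dz) t01.
have [dg cg] := Gamma0_fine_convex GgT (domg dy) (domg dz) t01.
have [dh ch] := Gamma0_fine_convex Gh dy dz t01.
move: hy hz; rewrite !primal_objectiveE// !lee_fin.
rewrite /real_objective; move: cf cg ch; rewrite /=.
move: (fine (f (_ + _))) (fine (g _)) (fine (h (_ + _))) => f1 g1 h1.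
have /andP[t0 t1] := t01 => cf cg ch hy hz.
have := ler_wpM2l (ltW t0) hy; have := ler_wpM2l (_ : 0 <= 1 - t) hz.
by rewrite subr_ge0 ltW// => /(_ isT); lra.
Qed.

End Primal_dual_problem.

Lemma bounded_operator_ge0 (R : realType) (U V : hilbertType R) (A : {linear U -> V}) :
  bounded_operator A -> exists2 N, 0 <= N & forall x, `|A x| <= N * `|x|.
Proof.
move=> [N AN]; exists `|N| => // x.
by apply: le_trans (AN x) _; rewrite ler_wpM2r// ler_norm.
Qed.

Lemma bounded_operator_continuous (R : realType) (U V : hilbertType R)
    (A : {linear U -> V}) : bounded_operator A -> continuous A.
Proof.
move=> /bounded_operator_ge0[N N0 AN] v; apply/cvgrPdist_lt => e e0.
have N1 : 0 < N + 1 by lra.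
have eN : 0 < e / (N + 1) by rewrite divr_gt0.
have : \forall w \near v, `|v - w| < e / (N + 1) by apply: cvgr_dist_lt.
apply: filterS => w; rewrite ltr_pdivlMr// => h; rewrite -linearB.
by apply: le_lt_trans (AN _) _; have := normr_ge0 (v - w); nra.
Qed.

(** * Estimates along the iterates *)

Section Algorithm.
Context {R : realType} {Hp Hd Hv : hilbertType R}.
Variables (A : {linear Hp -> Hd}) (T : {linear Hp -> Hv}) (b : Hd).
Variables (f h : Hp -> \bar R) (g : Hv -> \bar R).
Hypotheses (Gg : Gamma0 g) (Gf : Gamma0 f) (GgT : Gamma0 (g \o T)) (Gh : Gamma0 h).
Hypotheses (bounded_A : bounded_operator A) (bounded_T : bounded_operator T).
Variables (F : Hp -> \bar R) (zeta : R -> R).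
Hypothesis smooth_f : pair_smooth F zeta f (dom h).
Variables (Bc M : R).
Hypotheses (C_le : forall w, dom h w -> `|w| <= Bc).
Hypotheses (M_le : forall w, dom h w -> exists2 u, subdiff g (T w) u & `|u| <= M).
Variables (gamma beta theta rho : nat -> R) (rho_hi c : R).
Hypotheses (gamma01 : forall k, 0 < gamma k <= 1).
Hypotheses (beta_gt0 : forall k, 0 < beta k) (beta_noninc : nonincreasing_seq beta).
Hypotheses (rho01 : forall k, 0 <= rho k <= rho_hi) (rho_nondec : nondecreasing_seq rho).
Hypotheses (cvg_zeta : cvgn (series (fun k => zeta (gamma k)))).
Hypotheses (cvg_gamma2_beta : cvgn (series (fun k => gamma k ^+ 2 / beta k))).
Hypotheses (thetaE : forall k, theta k = gamma k / c).
Variables (x : nat -> Hp) (y : nat -> Hv) (z s : nat -> Hp) (mu : nat -> Hd).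
Hypothesis run : algorithm_run f g h T A b gamma beta theta rho x y z s mu.

Let domf : dom h `<=` dom f. Proof. by case: smooth_f. Qed.
Let domg w : dom h w -> dom g (T w).
Proof. by move=> /M_le[u /(subdiff_dom Gg)]. Qed.

Let conv_dom u v t : dom h u -> dom h v -> 0 < t < 1 ->
  dom h (t *: u + (1 - t) *: v).
Proof. by move=> hu hv t01; have [] := Gamma0_fine_convex Gh hu hv t01. Qed.

Let xS k : x k.+1 = x k + gamma k *: (s k - x k).
Proof. by rewrite (run_x run) -scalerN opprB. Qed.

Lemma iterate_s_dom k : dom h (s k).
Proof.
have [w hw] := Gamma0_dom Gh; have := run_s run k w.
apply: contraPP => /negP; rewrite -leNgt leye_eq => /eqP -> /=.
by rewrite addye// leye_eq -(dom_fineK (Gamma0_gtNy Gh) hw).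
Qed.

Lemma iterate_x_dom k : dom h (x k).
Proof.
elim: k => [|k IH]; first exact: run_x0 run.
have /andP[g0 g1] := gamma01 k; have hs := iterate_s_dom k.
have -> : x k.+1 = gamma k *: s k + (1 - gamma k) *: x k.
  by rewrite xS scalerBr scalerBl scale1r addrCA.
move: g1; rewrite le_eqVlt => /predU1P[->|g1].
  by rewrite subrr scale0r scale1r addr0.
by apply: conv_dom => //; rewrite g0.
Qed.

(** The gradient at [T (x k)] of the Moreau envelope of [g] of parameter [beta k]. *)
Let q k := (beta k)^-1 *: (T (x k) - y k).

Lemma iterate_y_subdiff k : subdiff g (y k) (q k).
Proof.
have [u hu _] := M_le (iterate_x_dom k).
by rewrite /q (run_y run); exact: prox_subdiff hu.
Qed.

Definition smoothed_objective k : R :=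
  fine (f (x k)) + (fine (g (y k)) + (2 * beta k)^-1 * `|T (x k) - y k| ^+ 2)
  + fine (h (x k)).

(** The augmented Lagrangian of the smoothed problem, measured from the level [p]. *)
Definition potential (p : R) k : R := smoothed_objective k +
  inner (mu k) (A (x k) - b) + rho k / 2 * `|A (x k) - b| ^+ 2 - p.

Lemma smoothed_objective_ge k :
  real_objective T f h g (x k) - beta k * (M ^+ 2 / 2) <= smoothed_objective k.
Proof.
have [u hu uM] := M_le (iterate_x_dom k).
have := moreau_lower Gg (beta_gt0 k) hu (subdiff_dom Gg (iterate_y_subdiff k)).
have : beta k / 2 * `|u| ^+ 2 <= beta k / 2 * M ^+ 2.
  rewrite ler_wpM2l ?divr_ge0 ?(ltW (beta_gt0 k))//.
  by rewrite lerXn2r ?nnegrE// (le_trans _ uM).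
rewrite /real_objective /smoothed_objective.
move: (fine _) (fine _) (fine _) (fine _) (beta k) (_ * `|_ - _| ^+ 2) (`|u| ^+ 2).
by move=> *; lra.
Qed.

(** The errors are chosen before [p] and [w], so one summable sequence serves both the solution and
    arbitrary comparison points. *)
Lemma potential_step : exists eps : nat -> R,
  [/\ forall k, 0 <= eps k, cvgn (series eps) &
   forall p k w, dom h w -> potential p k.+1 <= (1 - gamma k) * potential p k
    + gamma k * (real_objective T f h g w - p + inner (mu k) (A w - b) +
        rho k / 2 * (2 * inner (A w - b) (A (x k) - b) - `|A (x k) - b| ^+ 2))
    + gamma k / c * `|A (x k.+1) - b| ^+ 2 + eps k].
Proof.
have [NA NA0 hA] := bounded_operator_ge0 bounded_A.
have [NT NT0 hT] := bounded_operator_ge0 bounded_T.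
have [K K0 hK] := smooth_descent smooth_f conv_dom.
have zeta0 k : 0 <= zeta (gamma k) by case: smooth_f => _ z0 _ _ _; exact: z0.
have Bc0 : 0 <= Bc := le_trans (normr_ge0 _) (C_le (iterate_x_dom 0)).
pose d := 2 * Bc; have d0 : 0 <= d by rewrite mulr_ge0.
have diam u v : dom h u -> dom h v -> `|u - v| <= d.
  move=> /C_le hu /C_le hv; apply: le_trans (ler_normB _ _) _; rewrite /d; lra.
pose Rb := NA * Bc + `|b|.
have hR k : `|A (x k) - b| <= Rb.
  apply: le_trans (ler_normB _ _) _; rewrite lerD2r.
  by apply: le_trans (hA _) _; rewrite ler_wpM2l// C_le//; exact: iterate_x_dom.
pose eps k := K * zeta (gamma k) + (NT * d) ^+ 2 / 2 * (gamma k ^+ 2 / beta k) +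
  M ^+ 2 / 2 * (beta k - beta k.+1) + (NA * d) ^+ 2 / 2 * (rho k * gamma k ^+ 2) +
  Rb ^+ 2 / 2 * (rho k.+1 - rho k).
have g2b0 k : 0 <= gamma k ^+ 2 / beta k.
  by rewrite divr_ge0 ?sqr_ge0// ltW.
have dbeta0 k : 0 <= beta k - beta k.+1 by rewrite subr_ge0; exact: beta_noninc.
have drho0 k : 0 <= rho k.+1 - rho k by rewrite subr_ge0; exact: rho_nondec.
have rho0 k : 0 <= rho k by case/andP: (rho01 k).
have rg0 k : 0 <= rho k * gamma k ^+ 2 by rewrite mulr_ge0 ?sqr_ge0.
exists eps; split.
- by move=> k; rewrite /eps !addr_ge0// mulr_ge0// divr_ge0 ?sqr_ge0.
- have c1 : cvgn (series (fun k => beta k - beta k.+1)).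
    apply: (@bounded_series_cvgn _ _ (beta 0)) => // n.
    rewrite seriesEnat/= -[leLHS]opprK -sumrN.
    under eq_bigr do rewrite opprB.
    by rewrite telescope_sumr// opprB gerBl ltW.
  have c2 : cvgn (series (fun k => rho k.+1 - rho k)).
    apply: (@bounded_series_cvgn _ _ rho_hi) => // n.
    rewrite seriesEnat/= telescope_sumr//.
    have /andP[_] := rho01 n; have /andP[] := rho01 0; lra.
  have rhi0 : 0 <= rho_hi by case/andP: (rho01 0); exact: le_trans.
  (* Since [beta k <= beta 0], the series of [gamma k ^+ 2 / beta k] dominates. *)
  have c3 : cvgn (series (fun k => rho k * gamma k ^+ 2)).
    apply: (@series_le_cvg _ _ ((rho_hi * beta 0) *: (fun k => gamma k ^+ 2 / beta k))) => //.
    + by move=> k; rewrite !fctE /GRing.scale/= (mulr_ge0 _ (g2b0 k))// mulr_ge0// ltW.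
    + move=> k; rewrite !fctE /GRing.scale/= -mulrA.
      have /andP[_ rh] := rho01 k; apply: ler_pM => //; first exact: sqr_ge0.
      rewrite mulrCA ler_peMr ?sqr_ge0// ler_pdivlMr// mul1r.
      exact: beta_noninc.
    + exact: is_cvg_seriesZ.
  rewrite (_ : eps = K *: (fun k => zeta (gamma k))
    + ((NT * d) ^+ 2 / 2) *: (fun k => gamma k ^+ 2 / beta k)
    + (M ^+ 2 / 2) *: (fun k => beta k - beta k.+1)
    + ((NA * d) ^+ 2 / 2) *: (fun k => rho k * gamma k ^+ 2)
    + (Rb ^+ 2 / 2) *: (fun k => rho k.+1 - rho k)); last by [].
  by do 4! [apply: is_cvg_seriesD; last exact: is_cvg_seriesZ]; exact: is_cvg_seriesZ.
move=> p k w hw.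
have hx := iterate_x_dom k; have hx' := iterate_x_dom k.+1; have hs := iterate_s_dom k.
have [u hu uM] := M_le hx'.
have tanw := smooth_tangent Gf smooth_f hx hw.
have desc := hK _ _ _ hx hs (gamma01 k).
have zk := run_z run k.
have opt := run_s run k w.
have [G GE] : exists G, grad f (x k) = G by exists (grad f (x k)).
rewrite GE in tanw desc zk; rewrite -xS in desc.
have convh : fine (h (x k.+1)) <= (1 - gamma k) * fine (h (x k)) + gamma k * fine (h (s k)).
  have /andP[g0 g1] := gamma01 k.
  have -> : x k.+1 = gamma k *: s k + (1 - gamma k) *: x k.
    by rewrite xS scalerBr scalerBl scale1r addrCA.
  move: g1; rewrite le_eqVlt => /predU1P[->|g1].
    by rewrite subrr scale0r scale1r addr0; lra.
  have gk : 0 < gamma k < 1 by rewrite g0.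
  by rewrite [leRHS]addrC; exact: (Gamma0_fine_convex Gh hs hx gk).2.
have {opt}os : fine (h (s k)) + inner G (s k - w) + inner (q k) (T (s k - w)) +
    inner (mu k + rho k *: (A (x k) - b)) (A (s k - w)) <= fine (h w).
  have hNy := Gamma0_gtNy Gh.
  rewrite -(dom_fineK hNy hs) -(dom_fineK hNy hw) -!EFinD lee_fin in opt.
  (* The adjoints in [z k] are moved to the other side of the pairing. *)
  have zv v : inner (z k) v = inner G v + inner (q k) (T v) +
      inner (mu k + rho k *: (A (x k) - b)) (A v).
    rewrite zk !innerDl !innerZl !(innerC (adjoint _ _)) -!adjointP//.
    by rewrite !(innerC (A v)) (innerC (T v)) /q ?innerZl; ring.
  by move: opt; rewrite -addrA -addrA addrA; have := zv (s k - w); rewrite innerBr; lra.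
have := @one_step R Hp Hd Hv A T b g Gg (x k) (x k.+1) (s k) w G (y k) (y k.+1) u
  (mu k) (mu k.+1) (fine (f (x k))) (fine (f (x k.+1))) (fine (f w))
  (fine (h (x k))) (fine (h (x k.+1))) (fine (h (s k))) (fine (h w))
  (K * zeta (gamma k)) (beta k) (beta k.+1) (rho k) (rho k.+1) (gamma k) (gamma k / c)
  M NA NT d Rb p (potential p k) (potential p k.+1).
rewrite /real_objective; apply => //.
- by rewrite -thetaE; exact: run_mu run k.
- by case/andP: (gamma01 k) => /ltW.
- by rewrite beta_gt0; exact: beta_noninc.
- by rewrite rho0; exact: rho_nondec.
- exact: iterate_y_subdiff.
- exact: iterate_y_subdiff.
- exact: domg.
- by apply: le_trans (hA _) _; rewrite ler_wpM2l// diam.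
- by apply: le_trans (hT _) _; rewrite ler_wpM2l// diam.
Qed.

End Algorithm.

Theorem corollary4p3 (R : realType) (Hp Hd Hv : hilbertType R)
  (A : {linear Hp -> Hd}) (T : {linear Hp -> Hv}) (b : Hd)
  (f h : Hp -> \bar R) (g : Hv -> \bar R)
  (bounded_A : bounded_operator A) (bounded_T : bounded_operator T)
  (Gamma0_g : Gamma0 g)
  (Gamma0_f : Gamma0 f) (Gamma0_gT : Gamma0 (g \o T)) (Gamma0_h : Gamma0 h)
  (F : Hp -> \bar R) (zeta : R -> R)
  (smooth_f : pair_smooth F zeta f (dom h))
  (compact_C : weakly_compact (dom h))
  (T_C : T @` dom h `<=` dom_subdiff g)
  (subgrad_C : has_ubound [set `|min_subgrad g (T x)| | x in dom h])
  (Lh : R) (Lh_ge0 : 0 <= Lh)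
  (lipschitz_h : forall x z, dom h x -> dom h z ->
    (`|h x - h z| <= (Lh * `|x - z|)%:E)%E)
  (saddle_ex : exists (x : Hp) (mu : Hd), saddle_point f g h T A b x mu)
  (closed_ran : closed (range A))
  (qualification :
    (A @^-1` [set b] `&` interior (dom (g \o T)) `&` interior (dom h) !=set0)
    \/
    [/\ finite_dimensional Hp, finite_dimensional Hd,
        A @^-1` [set b] `&` relative_interior (dom (g \o T))
          `&` relative_interior (dom h) !=set0
      & range (adjoint A) `&`
          orthogonal_complement (linear_hull (dom (g \o T) `&` dom h))
        = [set 0]])
  (gamma beta theta rho : nat -> R)
  (beta_gt0 : forall k, 0 < beta k)
  (theta_ge0 : forall k, 0 <= theta k)
  (rho_ge0 : forall k, 0 <= rho k)
  (gamma_itv : forall k, 0 < gamma k <= 1)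
  (zeta_gamma : ell1_nneg (fun k => zeta (gamma k)))
  (gamma2_beta : ell1_nneg (fun k => gamma k ^+ 2 / beta k))
  (gamma_beta : ell1_nneg (fun k => gamma k * beta k))
  (gamma_nell1 : ~ ell1 gamma)
  (beta_noninc : nonincreasing_seq beta)
  (beta_cvg : beta @ \oo --> 0)
  (rho_nondec : nondecreasing_seq rho)
  (rho_lo rho_hi : R)
  (rho_loE : rho_lo%:E = ereal_inf (range (fun k => (rho k)%:E)))
  (rho_hiE : rho_hi%:E = ereal_sup (range (fun k => (rho k)%:E)))
  (rho_lo_gt0 : 0 < rho_lo)
  (M_lo M_hi : R) (M_lo_ge1 : 1 <= M_lo) (M_hi_gt0 : 0 < M_hi)
  (gamma_lo :
    (M_lo%:E <= ereal_inf (range (fun k => (gamma k / gamma k.+1)%:E)))%E)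
  (gamma_hi :
    (ereal_sup (range (fun k => (gamma k / gamma k.+1)%:E)) <= M_hi%:E)%E)
  (c : R) (c_gt0 : 0 < c)
  (thetaE : forall k, theta k = gamma k / c)
  (c_cond : M_hi / c - rho_lo / 2 < 0)
  (step_cond : forall k,
    rho k.+1 - rho k - gamma k.+1 * rho k.+1 + 2 / c * gamma k
      - gamma k ^+ 2 / c <= gamma k.+1)
  (x : nat -> Hp) (y : nat -> Hv) (z s : nat -> Hp) (mu : nat -> Hd)
  (run : algorithm_run f g h T A b gamma beta theta rho x y z s mu)
  (xs : Hp) (unique_sol : primal_solutions f g h T A b = [set xs]) :
  exists mus : Hd,
    saddle_point f g h T A b xs mus /\
    weakly_cvg_pair (fun k => (x k, mu k)) (xs, mus).
Proof.

(* Constants drawn from the hypotheses *)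
have [Bc Bc0 C_le] := weakly_compact_bounded compact_C.
have [NA NA0 hA] := bounded_operator_ge0 bounded_A.
have [M M0 M_le] : exists2 M, 0 <= M &
    forall w, dom h w -> exists2 u, subdiff g (T w) u & `|u| <= M.
  have [M hM] := subgrad_C; have [w0 hw0] := Gamma0_dom Gamma0_h.
  exists M; first by apply: le_trans (normr_ge0 _) (hM _ _); exists w0.
  move=> w hw; exists (min_subgrad g (T w)); last by apply: hM; exists w.
  by apply: min_subgradP => //; apply: T_C; exists w.
have domf : dom h `<=` dom f by case: smooth_f.
have domg w : dom h w -> dom g (T w).
  by move=> /M_le[u /(subdiff_dom Gamma0_g)].
have gamma0 k : 0 <= gamma k by case/andP: (gamma_itv k) => /ltW.
have rho_lo_le k : rho_lo <= rho k.
  by rewrite -lee_fin rho_loE; apply: ereal_inf_lbound; exists k.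
have rho_hi_ge k : rho k <= rho_hi.
  by rewrite -lee_fin rho_hiE; apply: ereal_sup_ubound; exists k.
have rho01 k : 0 <= rho k <= rho_hi by rewrite rho_ge0 rho_hi_ge.
have M_hi_ge1 : 1 <= M_hi.
  rewrite -lee_fin; apply: (@le_trans _ _ (gamma 0 / gamma 1)%:E).
    apply: (@le_trans _ _ M_lo%:E); first by rewrite lee_fin.
    by apply: (le_trans gamma_lo); apply: ereal_inf_lbound; exists 0.
  by apply: (le_trans _ gamma_hi); apply: ereal_sup_ubound; exists 0.
(* The margin is positive by [c_cond], because [M_hi] is at least 1. *)
pose del := rho_lo / 2 - c^-1.
have del0 : 0 < del.
  have : c^-1 <= M_hi / c by rewrite ler_peMl// invr_ge0 ltW.
  by rewrite /del; lra.
have rho_del k : c^-1 + del <= rho k / 2.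
  by rewrite /del; have := rho_lo_le k; lra.
have czeta := ell1_nneg_series zeta_gamma.
have cg2b := ell1_nneg_series gamma2_beta.
have cgb := ell1_nneg_series gamma_beta.
have ncg : ~ cvgn (series gamma).
  move=> cg; apply: gamma_nell1; rewrite /ell1/=.
  by under eq_fun do rewrite ger0_norm//.
have beta_le k : beta k <= beta 0 by exact: beta_noninc.
have cg2 : cvgn (series (fun k => gamma k ^+ 2)).
  apply: (@series_le_cvg _ _ (beta 0 *: (fun k => gamma k ^+ 2 / beta k))).
  - by move=> k; rewrite sqr_ge0.
  - by move=> k; rewrite !fctE /GRing.scale/= mulr_ge0 ?divr_ge0 ?sqr_ge0 ?(ltW (beta_gt0 _)).
  - move=> k; rewrite !fctE /GRing.scale/= mulrCA ler_peMr ?sqr_ge0//.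
    by rewrite ler_pdivlMr// mul1r.
  - exact: is_cvg_seriesZ.
have xC := iterate_x_dom Gamma0_h gamma_itv run.
have [eps [eps0 ceps step]] := potential_step Gamma0_g Gamma0_f Gamma0_h
  bounded_A bounded_T smooth_f C_le M_le gamma_itv beta_gt0 beta_noninc rho01
  rho_nondec czeta cg2b thetaE run.
have objge := smoothed_objective_ge Gamma0_g Gamma0_h M_le gamma_itv beta_gt0 run.
pose r k := A (x k) - b; pose Rb := NA * Bc + `|b|.
have rR k : `|r k| <= Rb.
  apply: le_trans (ler_normB _ _) _; rewrite lerD2r.
  by apply: le_trans (hA _) _; rewrite ler_wpM2l// C_le.
have sC := iterate_s_dom Gamma0_h run.
have rstep k : `|r k.+1 - r k| <= NA * (2 * Bc) * gamma k.
  have -> : r k.+1 - r k = gamma k *: A (s k - x k).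
    rewrite /r opprB addrA subrK (run_x run) -linearB addrAC subrr add0r.
    by rewrite -scalerN opprB linearZ.
  rewrite normrZ ger0_norm// mulrC ler_wpM2r//; apply: le_trans (hA _) _.
  rewrite ler_wpM2l//; apply: le_trans (ler_normB _ _) _.
  by have := C_le _ (xC k); have := C_le _ (sC k); lra.

(* Dual solutions and the potential at the optimal value *)
have [x1 [m0 sp0]] := saddle_ex.
have [Ax1 hx1 dual0] := saddle_point_dual Gamma0_g Gamma0_f Gamma0_h domf domg sp0.
have objE := primal_objectiveE Gamma0_g Gamma0_f Gamma0_h domf domg.
(* The dual inequality loses its multiplier term at feasible points, so [x1] attains the optimal
   value and uniqueness identifies it with [xs]. *)
have sol_of w : A w = b -> dom h w ->
    real_objective T f h g w <= real_objective T f h g x1 -> w = xs.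
  move=> Aw hw ow; suff : primal_solutions f g h T A b w by rewrite unique_sol.
  split=> // v Av; have [hv|hv] := pselect (dom h v); last first.
    by rewrite (primal_objective_ndom T Gamma0_g Gamma0_f hv) leey.
  rewrite !objE// lee_fin (le_trans ow)//.
  by have := dual0 v hv; rewrite Av subrr inner0r addr0.
have x1xs : x1 = xs by exact: sol_of.
rewrite x1xs in Ax1 hx1 dual0 sol_of; clear x1 sp0 x1xs.
pose p := real_objective T f h g xs.
pose V := potential A T b f h g beta rho x y mu p.
pose dual m := forall w, dom h w -> p <= real_objective T f h g w + inner m (A w - b).
have muS k : mu k.+1 = mu k + (gamma k / c) *: r k.+1.
  by rewrite -thetaE; exact: run_mu run k.
have Vstep k : V k.+1 <= (1 - gamma k) * V k - gamma k * (rho k / 2 * `|r k| ^+ 2)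
   + gamma k / c * `|r k.+1| ^+ 2 + eps k.
  by have := step p k xs hx1; rewrite Ax1 !subrr !(inner0l, inner0r) /V /r /p; lra.
have Vge m : dual m -> forall k,
    inner (mu k - m) (r k) + rho k / 2 * `|r k| ^+ 2 - beta k * (M ^+ 2 / 2) <= V k.
  move=> dm k; have := dm _ (xC k); have := objge k.
  by rewrite /V /potential innerBl -/(r k); lra.
have M20 : 0 <= M ^+ 2 / 2 by rewrite divr_ge0 ?sqr_ge0.
have NB0 : 0 <= NA * (2 * Bc) by rewrite !mulr_ge0.
have Rb0 : 0 <= Rb := le_trans (normr_ge0 _) (rR 0).
have beta0 k : 0 <= beta k by exact: ltW.
have r0 := residual_cvg0 gamma_itv c_gt0 M20 NB0 Rb0 eps0 ceps cg2 beta0 beta_le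
  cgb ncg del0 rho_del muS rR rstep Vstep (Vge _ dual0).
have [Q hQ] := multiplier_bounded gamma_itv c_gt0 M20 NB0 Rb0 eps0 ceps cg2 beta0 beta_le
  cgb del0 rho_del muS rR rstep Vstep (Vge _ dual0).
have V0 := potential_cvg0 gamma_itv c_gt0 M20 NB0 Rb0 eps0 ceps cg2 beta0 beta_le
  beta_cvg cgb ncg del0 rho_del muS rR rstep Vstep (Vge _ dual0).
have Dcvg m (dm : dual m) := multiplier_distance_cvg gamma_itv c_gt0 M20 NB0 Rb0 eps0
  ceps cg2 beta0 beta_le beta_cvg cgb ncg del0 rho_del muS rR rstep Vstep (Vge _ dm).
have muB k : `|mu k| <= Q + `|m0|.
  by rewrite -[mu k](subrK m0) (le_trans (ler_normD _ _))// lerD2r.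

(* Weak convergence of the multipliers *)
have dual_limit (U : set_system nat) m : UltraFilter U -> \oo `<=` U ->
    (forall u, inner u (mu n) @[n --> U] --> inner u m) -> dual m.
  move=> UU oU hm w hw; rewrite -lerBlDl -[leRHS]addr0.
  apply/ler_addgt0Pr => eta eta0; rewrite addr0 [inner m _]innerC.
  rewrite -lerBlDr.
  apply: (cvgr_to_ge (hm (A w - b))).
  have step_w k : V k.+1 <= (1 - gamma k) * V k + gamma k *
      (real_objective T f h g w - p + inner (mu k) (A w - b) +
        rho k / 2 * (2 * inner (A w - b) (r k) - `|r k| ^+ 2))
      + gamma k / c * `|r k.+1| ^+ 2 + eps k by exact: step.
  (* The bound holds for all large indices, hence along [U], and passes to the weak limit with [eta]
     arbitrary. *)
  have /oU := dual_gap_liminf gamma_itv c_gt0 eps0 ceps ncg rho01 muS r0 V0 step_w eta0.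
  by apply: filterS => k; rewrite innerC; lra.
have [ms dms mu_ms] := opial muB Dcvg dual_limit.
exists ms; split.
  exact: (dual_saddle_point Gamma0_g Gamma0_f Gamma0_h domf domg Ax1 hx1 dms).

(* Weak convergence of the primal iterates *)
have obj_limit e : 0 < e ->
    \forall k \near \oo, (primal_objective f g h T (x k) <= (p + e)%:E)%E.
  move=> e0.
  (* Besides the potential, the excess over [p] involves the multiplier term, bounded through [muB],
     and the smoothing gap of order [beta k]. *)
  have gap0 : (fun k => V k + (Q + `|m0|) * `|r k| + beta k * (M ^+ 2 / 2)) @ \oo --> 0.
    rewrite -[X in _ --> X]addr0; apply: cvgD.
      rewrite -[X in _ --> X]addr0; apply: cvgD => //.
      rewrite -[X in _ --> X](mulr0 (Q + `|m0|)); apply: cvgM => //; exact: cvg_cst.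
    rewrite -[X in _ --> X](mul0r (M ^+ 2 / 2)); apply: cvgM => //; exact: cvg_cst.
  move/cvgr0Pnorm_lt : gap0 => /(_ e e0); apply: filterS => k.
  move=> /(le_lt_trans (ler_norm _)) hk; rewrite objE// lee_fin.
  have := objge k; have : 0 <= rho k / 2 * `|r k| ^+ 2.
    by rewrite mulr_ge0 ?sqr_ge0// divr_ge0.
  have : - ((Q + `|m0|) * `|r k|) <= inner (mu k) (r k).
    have := normr_inner (mu k) (r k); rewrite ler_norml => /andP[h1 _].
    by apply: le_trans h1; rewrite lerN2 ler_wpM2r.
  by move: hk; rewrite /V /potential -/(r k); lra.
have x_xs u : inner u (x n) @[n --> \oo] --> inner u xs.
  apply: (weak_cvg_of_unique_limit (fun k => C_le _ (xC k))) => U w UU oU hw.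
  have ow e : 0 < e -> (primal_objective f g h T w <= (p + e)%:E)%E.
    move=> e0; have clS := closed_primal_sublevel Gamma0_g Gamma0_f Gamma0_gT Gamma0_h (e := p + e).
    apply: (weak_limit_closed_convex _ clS _ hw).
      by move=> v v' t; exact: convex_primal_sublevel.
    by apply: oU; exact: obj_limit.
  have Cw : dom h w.
    apply/not_notP => nC; have := ow 1 ltr01.
    by rewrite (primal_objective_ndom T Gamma0_g Gamma0_f nC) leye_eq.
  apply: sol_of => //; last first.
    by apply/ler_addgt0Pr => e e0; have := ow e e0; rewrite objE// lee_fin.
  apply/eqP; rewrite -subr_eq0 -normr_eq0 eq_le normr_ge0 andbT.
  apply/ler_addgt0Pr => e e0; rewrite add0r.
  apply: (weak_limit_closed_convex (U := U) (K := [set w | `|A w - b| <= e]) _ _ _ hw).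
  - apply: (@closed_comp _ _ (fun w => `|A w - b| : R^o) [set a | a <= e]); last exact: closed_le.
    move=> v _; apply: cvg_norm; apply: cvgB; [exact: bounded_operator_continuous|exact: cvg_cst].
  - move=> v v' t /= hv hv' /andP[t0 t1].
    have -> : A (t *: v + (1 - t) *: v') - b = t *: (A v - b) + (1 - t) *: (A v' - b).
      rewrite linearD !linearZ/= !scalerBr addrACA -opprD -scalerDl.
      by rewrite addrCA subrr addr0 scale1r.
    have t1' : 0 <= 1 - t by rewrite subr_ge0 ltW.
    apply: le_trans (ler_normD _ _) _.
    rewrite !normrZ (ger0_norm (ltW t0)) (ger0_norm t1').
    apply: le_trans (lerD (ler_wpM2l (ltW t0) hv) (ler_wpM2l t1' hv')) _.
    by rewrite -mulrDl addrC subrK mul1r.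
  - have rk : \forall k \near \oo, `|A (x k) - b| <= e.
      move/cvgr0Pnorm_lt : r0 => /(_ e e0)[N _ hN].
      by exists N => // k /hN /=; rewrite normr_id => /ltW.
    exact: oU rk.
(* A product neighbourhood contains a box of weak neighbourhoods, each of which is eventually
   entered. *)
move=> N [[P Q'] [/= xsP msQ'] PQN].
have [n1 _ hn1] := weakly_cvg x_xs xsP; have [n2 _ hn2] := weakly_cvg mu_ms msQ'.
exists (maxn n1 n2) => // n; rewrite /= geq_max => /andP[n1n n2n].
by apply: PQN; split; [exact: hn1|exact: hn2].
Qed.
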